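(* Let $G=(V,E)$ be a graph on $n$ vertices and $k$ a positive integer. Then it can be decided in $\mathcal{O}(n^{5k+3})$ time whether $\mathrm{box}(\overline{L(G)})\le k$.
   Context: Graphs are simple. The line graph $L(G)$ has vertex set $E$, two edges adjacent iff they share an endpoint; $\overline{H}$ is the complement of $H$. The boxicity $\mathrm{box}(H)$ is the minimum $d\ge 0$ such that $H$ is the intersection graph of a family of axis-parallel boxes in $\mathbb{R}^d$ (products of $d$ closed real intervals), one box per vertex, distinct vertices adjacent iff their boxes intersect. *)

(* Defs.v *)
From mathcomp Require Import all_boot all_order all_algebra.
From mathcomp Require Import boolp classical_sets reals.

Set Implicit Arguments.
Unset Strict Implicit.
Unset Printing Implicit Defensive.

Import Order.TTheory GRing.Theory Num.Theory.

Record sgraph (T : finType) := SGraph {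
  adj :> rel T;
  adj_sym : symmetric adj;
  adj_irr : irreflexive adj }.

Section GraphOps.
Variables (T : finType) (G : sgraph T).

Definition edges : {set {set T}} :=
  [set [set p.1; p.2] | p : T * T & G p.1 p.2].

Definition edge_type : finType := {A : {set T} | A \in edges}.

Definition line_rel : rel edge_type :=
  fun A B => (A != B) && (val A :&: val B != finset.set0).

Lemma line_rel_sym : symmetric line_rel.
Proof. by move=> A B; rewrite /line_rel eq_sym finset.setIC. Qed.

Lemma line_rel_irr : irreflexive line_rel.
Proof. by move=> A; rewrite /line_rel eqxx. Qed.

Definition line_graph : sgraph edge_type := SGraph line_rel_sym line_rel_irr.

Definition compl_rel : rel T := fun x y => (x != y) && ~~ G x y.

Lemma compl_rel_sym : symmetric compl_rel.
Proof. by move=> x y; rewrite /compl_rel eq_sym adj_sym. Qed.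

Lemma compl_rel_irr : irreflexive compl_rel.
Proof. by move=> x; rewrite /compl_rel eqxx. Qed.

Definition compl_graph : sgraph T := SGraph compl_rel_sym compl_rel_irr.

End GraphOps.

Section Boxicity.
Local Open Scope ring_scope.
Local Open Scope classical_set_scope.
Variable R : realType.

Definition closed_box (d : nat) (lo hi : 'rV[R]_d) : set 'rV[R]_d :=
  [set p | forall i, lo 0 i <= p 0 i <= hi 0 i].

Definition box_representable (T : finType) (H : sgraph T) (d : nat) : Prop :=
  exists lo hi : T -> 'rV[R]_d,
    (forall v i, lo v 0 i <= hi v 0 i) /\
    (forall u v, u != v ->
       (H u v <->
        closed_box (lo u) (hi u) `&` closed_box (lo v) (hi v) !=set0)).

(* One coordinate per vertex w: w gets [0,0], its neighbours [0,1], and all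
   other vertices [1,1]. *)
Lemma box_representable_card (T : finType) (H : sgraph T) :
  box_representable H #|T|.
Proof.
exists (fun v => \row_i
  (if (v == enum_val i) || H (enum_val i) v then 0 else 1)).
exists (fun v => \row_i (if v == enum_val i then 0 else 1)); split=> [v i|u v uv].
  by rewrite !mxE; case: eqP => //= _; case: ifP.
split=> [Huv|[p [/(_ (enum_rank u)) pu /(_ (enum_rank u)) pv]]].
  exists (\row_i (if (u == enum_val i) || (v == enum_val i) then 0 else 1)).
  split=> i; rewrite !mxE.
    case: (eqVneq u) => [<-|nu] /=; first by rewrite lexx.
    case: (eqVneq v) => [<-|nv] /=; last by case: ifP; rewrite ?lexx ?ler01.
    by rewrite (adj_sym H v) Huv lexx ler01.
  case: (eqVneq v) => [<-|nv] /=; first by rewrite orbT lexx.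
  rewrite orbF; case: (eqVneq u) => [<-|nu] /=; first by rewrite Huv lexx ler01.
  by case: ifP; rewrite ?lexx ?ler01.
move: pu pv; rewrite !mxE enum_rankK eqxx /= (eq_sym v) (negbTE uv) /=.
case: ifP => // _ /andP[_ p0] /andP[p1 _].
by have := le_trans p1 p0; rewrite ler10.
Qed.

Lemma ex_box_representable (T : finType) (H : sgraph T) :
  exists d, `[< box_representable H d >].
Proof. by exists #|T|; apply/asboolP/box_representable_card. Qed.

Definition boxicity (T : finType) (H : sgraph T) : nat :=
  ex_minn (ex_box_representable H).

End Boxicity.

(* Word RAM with unit costs: finitely many registers are named by a program,
   memory is addressed indirectly, and control flow is structured. Subtraction
   is truncated; x / 0 = 0 and x mod 0 = x. *)
Inductive ram_op := OpAdd | OpSub | OpMul | OpDiv | OpMod | OpLt | OpEq.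

Definition eval_op (o : ram_op) (x y : nat) : nat :=
  match o with
  | OpAdd => x + y
  | OpSub => x - y
  | OpMul => x * y
  | OpDiv => x %/ y
  | OpMod => x %% y
  | OpLt => x < y
  | OpEq => x == y
  end.

Inductive ram_com :=
  | CSkip
  | CConst (x v : nat)
  | COp (o : ram_op) (x y z : nat)
  | CLoad (x y : nat)
  | CStore (x y : nat)
  | CSeq (c1 c2 : ram_com)
  | CIf (x : nat) (c1 c2 : ram_com)
  | CWhile (x : nat) (c : ram_com).

Record ram_state := RamState { reg : nat -> nat; mem : nat -> nat }.

Definition upd (f : nat -> nat) (a v : nat) : nat -> nat :=
  fun b => if b == a then v else f b.

Definition set_reg (s : ram_state) (x v : nat) : ram_state :=
  RamState (upd (reg s) x v) (mem s).

Definition set_mem (s : ram_state) (a v : nat) : ram_state :=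
  RamState (reg s) (upd (mem s) a v).

(* exec B c s t s': c started in s halts in s' after exactly t unit-cost steps.
   Every word computed must be smaller than B: a run that would overflow is
   stuck, hence does not count as halting. *)
Inductive exec (B : nat) : ram_com -> ram_state -> nat -> ram_state -> Prop :=
  | exec_skip s : exec B CSkip s 1 s
  | exec_const s x v : v < B -> exec B (CConst x v) s 1 (set_reg s x v)
  | exec_op s o x y z :
      eval_op o (reg s y) (reg s z) < B ->
      exec B (COp o x y z) s 1 (set_reg s x (eval_op o (reg s y) (reg s z)))
  | exec_load s x y :
      mem s (reg s y) < B ->
      exec B (CLoad x y) s 1 (set_reg s x (mem s (reg s y)))
  | exec_store s x y :
      reg s y < B ->
      exec B (CStore x y) s 1 (set_mem s (reg s x) (reg s y))
  | exec_seq s1 s2 s3 t1 t2 c1 c2 :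
      exec B c1 s1 t1 s2 -> exec B c2 s2 t2 s3 ->
      exec B (CSeq c1 c2) s1 (t1 + t2) s3
  | exec_if_true s s' t x c1 c2 :
      reg s x != 0 -> exec B c1 s t s' -> exec B (CIf x c1 c2) s t.+1 s'
  | exec_if_false s s' t x c1 c2 :
      reg s x = 0 -> exec B c2 s t s' -> exec B (CIf x c1 c2) s t.+1 s'
  | exec_while_end s x c :
      reg s x = 0 -> exec B (CWhile x c) s 1 s
  | exec_while_step s1 s2 s3 t1 t2 x c :
      reg s1 x != 0 -> exec B c s1 t1 s2 -> exec B (CWhile x c) s2 t2 s3 ->
      exec B (CWhile x c) s1 (t1 + t2).+1 s3.

Lemma exec_det B c s t1 s1 t2 s2 :
  exec B c s t1 s1 -> exec B c s t2 s2 -> t1 = t2 /\ s1 = s2.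
Proof.
move=> E; elim: E t2 s2 => {c s t1 s1}.
- by move=> s t2 s2 E; inversion E.
- by move=> s x v _ t2 s2 E; inversion E.
- by move=> s o x y z _ t2 s2 E; inversion E.
- by move=> s x y _ t2 s2 E; inversion E.
- by move=> s x y _ t2 s2 E; inversion E.
- move=> s1 s2 s3 t1 t2 c1 c2 _ IH1 _ IH2 t s E; inversion E; subst.
  by case: (IH1 _ _ ltac:(eassumption)) => -> ?; subst;
     case: (IH2 _ _ ltac:(eassumption)) => -> ->.
- move=> s s' t x c1 c2 /eqP nz _ IH t2 s2 E; inversion E; subst=> //.
  by case: (IH _ _ ltac:(eassumption)) => -> ->.
- move=> s s' t x c1 c2 z _ IH t2 s2 E; inversion E as [| | | | | |? ? ? ? ? ? nz| | |];
    subst; first by rewrite z in nz.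
  by case: (IH _ _ ltac:(eassumption)) => -> ->.
- move=> s x c z t2 s2 E; inversion E as [| | | | | | | | |? ? ? ? ? ? ? nz];
    subst=> //; by rewrite z in nz.
- move=> s1 s2 s3 t1 t2 x c /eqP nz _ IH1 _ IH2 t s E; inversion E; subst=> //.
  by case: (IH1 _ _ ltac:(eassumption)) => -> ?; subst;
     case: (IH2 _ _ ltac:(eassumption)) => -> ->.
Qed.

(* Register 0 holds n, register 1 holds k, and memory cells 0, ..., n^2 - 1 hold
   the adjacency matrix row by row; everything else is 0. *)
Definition graph_input (n : nat) (G : sgraph 'I_n) (k : nat) : ram_state :=
  RamState
    (fun x => match x with 0 => n | 1 => k | _ => 0 end)
    (fun a => [exists i : 'I_n, exists j : 'I_n, (a == i * n + j) && G i j]).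

Definition bigO_nat (T f : nat -> nat) : Prop :=
  exists C N, forall n, N <= n -> T n <= C * f n.

(* The answer is left in register 0 (1 = yes, 0 = no), f bounds the running time
   up to a constant factor, and words have O(log n) bits. *)
Definition decides_in_time (p : ram_com) (k : nat)
    (P : forall n, sgraph 'I_n -> bool) (f : nat -> nat) : Prop :=
  exists (T : nat -> nat) (c : nat), bigO_nat T f /\
    forall n (G : sgraph 'I_n), exists t s,
      [/\ exec (n.+2 ^ c) p (graph_input G k) t s,
          t <= T n & reg s 0 = P n G].

(* Main.v *)
Require Import Defs.
From mathcomp Require Import all_boot.
From mathcomp Require Import reals.
From mathcomp Require Import all_order all_algebra boolp zify.

Set Implicit Arguments.
Unset Strict Implicit.
Unset Printing Implicit Defensive.

(* The complement of L(G) has boxicity at most k iff the edges of G can be given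
   k intervals each so that two distinct edges share a vertex exactly when they
   are separated in some coordinate. Instead of enumerating the O(n^5) maximal
   co-interval subgraphs of L(G), we reduce to a kernel whose size depends on k
   only. In each coordinate at most 8 vertices v have two edges at v separated,
   so a graph that admits a representation has at most 8k vertices of degree at
   least 2 (the core). If a core vertex already has two leaves, two of its leaf
   edges are separated in some coordinate, and every edge avoiding this vertex
   covers the gap between them; further leaf edges fit into that gap. So two
   leaves per core vertex suffice, and components with a single edge are
   irrelevant: at most 24k vertices remain. On them all assignments of
   endpoints, coded as the digits of one number, are tried. Everything is
   recomputed from the adjacency matrix by nested loops, of which at most 8
   range over the n vertices, and 8 <= 5k + 3. *)

(** * Compiling bounded arithmetic to the machine *)

(* EVar i is the i-th innermost bound variable; EN and EK are the inputs n and
   k. EBig o x0 poly m b folds o over the values of b for 0 <= i < m, starting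
   at x0; poly marks the loops whose length is bounded by n, the length of the
   others being bounded in terms of k. *)
Inductive expr :=
  | EVar (i : nat)
  | EN
  | EK
  | EC (v : nat)
  | EOp (o : ram_op) (a b : expr)
  | EMem (a : expr)
  | ELet (a b : expr)
  | EIf (a b c : expr)
  | EBig (o : ram_op) (x0 : nat) (poly : bool) (m b : expr).

Definition CCopy (x y z : nat) : ram_com :=
  CSeq (CConst z 0) (COp OpAdd x y z).

(* The result goes to register d; registers below d are preserved, and rs lists
   those that hold the bound variables. *)
Fixpoint compile (rs : seq nat) (d : nat) (e : expr) : ram_com :=
  match e with
  | EVar i => CCopy d (nth 0 rs i) d
  | EN => CCopy d 0 d
  | EK => CCopy d 1 d
  | EC v => CConst d v
  | EOp o a b =>
      CSeq (compile rs d a) (CSeq (compile rs d.+1 b) (COp o d d d.+1))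
  | EMem a => CSeq (compile rs d a) (CLoad d d)
  | ELet a b =>
      CSeq (compile rs d a)
        (CSeq (compile (d :: rs) d.+1 b) (CCopy d d.+1 d))
  | EIf a b c =>
      CSeq (compile rs d a) (CIf d (compile rs d b) (compile rs d c))
  | EBig o x0 _ m b =>
      CSeq (compile rs d m)
     (CSeq (CConst d.+1 0)
     (CSeq (CConst d.+2 x0)
     (CSeq (COp OpLt d.+3 d.+1 d)
     (CSeq (CWhile d.+3
             (CSeq (compile (d.+1 :: rs) d.+4 b)
             (CSeq (COp o d.+2 d.+2 d.+4)
             (CSeq (CConst d.+4 1)
             (CSeq (COp OpAdd d.+1 d.+1 d.+4)
                   (COp OpLt d.+3 d.+1 d))))))
           (CCopy d d.+2 d)))))
  end.

(** * Running time of compiled expressions *)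

Section TimeBound.
Variables n1 H : nat.

(** In a loop, 5 pays for the four instructions after the body and the test of the flag, and 6 for
    three initialisations, the failing test and the final copy. *)
Fixpoint time_bound (e : expr) : nat :=
  match e with
  | EVar _ | EN | EK => 2
  | EC _ => 1
  | EOp _ a b => time_bound a + time_bound b + 1
  | EMem a => time_bound a + 1
  | ELet a b => time_bound a + time_bound b + 2
  | EIf a b c => time_bound a + time_bound b + time_bound c + 1
  | EBig _ _ poly m b =>
      time_bound m + (if poly then n1 else H) * (time_bound b + 5) + 6
  end.

Fixpoint expr_size (e : expr) : nat :=
  match e with
  | EVar _ | EN | EK | EC _ => 2
  | EOp _ a b | ELet a b => expr_size a + expr_size b + 2
  | EMem a => expr_size a + 1
  | EIf a b c => expr_size a + expr_size b + expr_size c + 1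
  | EBig _ _ _ m b => expr_size m + expr_size b + 11
  end.

Fixpoint loop_depth (poly : bool) (e : expr) : nat :=
  match e with
  | EVar _ | EN | EK | EC _ => 0
  | EOp _ a b | ELet a b => maxn (loop_depth poly a) (loop_depth poly b)
  | EMem a => loop_depth poly a
  | EIf a b c =>
      maxn (loop_depth poly a) (maxn (loop_depth poly b) (loop_depth poly c))
  | EBig _ _ p m b =>
      maxn (loop_depth poly m) ((p == poly) + loop_depth poly b)
  end.

(** Consecutive parts add their coefficients and share the larger exponents; a loop raises one
    exponent by 1. *)
Lemma time_bound_le e : 0 < n1 -> 0 < H ->
  time_bound e <= expr_size e * (n1 ^ loop_depth true e * H ^ loop_depth false e).
Proof.
move=> n1_gt0 H_gt0.
have mono x1 y1 x2 y2 : x1 <= x2 -> y1 <= y2 ->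
    n1 ^ x1 * H ^ y1 <= n1 ^ x2 * H ^ y2.
  by move=> hx hy; apply: leq_mul; apply: leq_pexp2l.
have pos x y : 0 < n1 ^ x * H ^ y by rewrite muln_gt0 !expn_gt0 n1_gt0 H_gt0.
have weaken t z x1 y1 x2 y2 : t <= z * (n1 ^ x1 * H ^ y1) ->
    x1 <= x2 -> y1 <= y2 -> t <= z * (n1 ^ x2 * H ^ y2).
  by move=> ht hx hy; apply: leq_trans ht _; rewrite leq_mul2l mono ?orbT.
elim: e => //=.
- move=> o a IHa b IHb.
  set x := maxn _ _; set y := maxn _ _.
  have := pos x y.
  have := weaken _ _ _ _ x y IHa (leq_maxl _ _) (leq_maxl _ _).
  have := weaken _ _ _ _ x y IHb (leq_maxr _ _) (leq_maxr _ _).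
  by nia.
- by move=> a IHa; have := pos (loop_depth true a) (loop_depth false a); nia.
- move=> a IHa b IHb.
  set x := maxn _ _; set y := maxn _ _.
  have := pos x y.
  have := weaken _ _ _ _ x y IHa (leq_maxl _ _) (leq_maxl _ _).
  have := weaken _ _ _ _ x y IHb (leq_maxr _ _) (leq_maxr _ _).
  by nia.
- move=> a IHa b IHb c IHc.
  set x := maxn _ _; set y := maxn _ _.
  have := pos x y.
  have := weaken _ _ _ _ x y IHa ltac:(lia) ltac:(lia).
  have := weaken _ _ _ _ x y IHb ltac:(lia) ltac:(lia).
  have := weaken _ _ _ _ x y IHc ltac:(lia) ltac:(lia).
  by nia.
- move=> o x0 p m IHm b IHb.
  set x := maxn _ _; set y := maxn _ _.
  have := weaken _ _ _ _ x y IHm (leq_maxl _ _) (leq_maxl _ _).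
  set L := if p then n1 else H.
  have hb : L * time_bound b <= expr_size b * (n1 ^ x * H ^ y).
    apply: (@weaken _ _ ((p == true) + loop_depth true b)
              ((p == false) + loop_depth false b));
      rewrite ?leq_maxr // !expnD /L.
    by case: (p) => /=; rewrite !expn1 expn0; nia.
  have hL : L <= n1 ^ x * H ^ y.
    rewrite -[X in _ <= X]mul1n.
    apply: (@weaken _ _ (p == true) (p == false));
      rewrite /L /x /y; try by rewrite leq_max leq_addr orbT.
    by case: (p); rewrite /= ?expn0 ?expn1; nia.
  by have := pos x y; nia.
Qed.

End TimeBound.

(** * Semantics of expressions and correctness of the compiler *)

Section Compilation.
Variables (B n k n1 H : nat) (M : nat -> nat).
Hypothesis B_gt1 : 1 < B.

(* An unbound variable reads n because the default of nth 0 rs i in compile is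
   register 0. *)
Fixpoint eval (e : expr) (env : seq nat) : nat :=
  match e with
  | EVar i => nth n env i
  | EN => n
  | EK => k
  | EC v => v
  | EOp o a b => eval_op o (eval a env) (eval b env)
  | EMem a => M (eval a env)
  | ELet a b => eval b (eval a env :: env)
  | EIf a b c => if eval a env != 0 then eval b env else eval c env
  | EBig o x0 _ m b =>
      iteri (eval m env) (fun i acc => eval_op o acc (eval b (i :: env))) x0
  end.

(** A word reaching [B] would leave the machine stuck; for a fold this concerns every partial
    result, from [x0] to the last. *)
Fixpoint safe (e : expr) (env : seq nat) : Prop :=
  match e with
  | EVar i => nth n env i < B
  | EN => n < B
  | EK => k < B
  | EC v => v < B
  | EOp o a b =>
      [/\ safe a env, safe b env & eval_op o (eval a env) (eval b env) < B]
  | EMem a => safe a env /\ M (eval a env) < B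
  | ELet a b => safe a env /\ safe b (eval a env :: env)
  | EIf a b c =>
      safe a env /\ (if eval a env != 0 then safe b env else safe c env)
  | EBig o x0 poly m b =>
      [/\ safe m env,
          eval m env <= (if poly then n1 else H),
          forall i, i < eval m env -> safe b (i :: env) &
          forall j, j <= eval m env ->
            iteri j (fun i acc => eval_op o acc (eval b (i :: env))) x0 < B]
  end.

Lemma safe_eval e env : safe e env -> eval e env < B.
Proof.
elim: e env => //=.
- by move=> o a _ b _ env [].
- by move=> a _ env [].
- by move=> a _ b IHb env [_ /IHb].
- by move=> a _ b IHb c IHc env [_]; case: ifP => _; [apply: IHb|apply: IHc].
- by move=> o x0 poly m _ b _ env [_ _ _]; apply.
Qed.

Definition extends (d : nat) (s s' : ram_state) : Prop :=
  Defs.mem s' = Defs.mem s /\ forall x, x < d -> reg s' x = reg s x.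

Lemma extends_trans d s1 s2 s3 :
  extends d s1 s2 -> extends d s2 s3 -> extends d s1 s3.
Proof.
by move=> [e1 h1] [e2 h2]; split=> [|x xd]; rewrite ?e2 ?h2 ?e1 ?h1.
Qed.

Lemma extends_leq d d' s s' : d <= d' -> extends d' s s' -> extends d s s'.
Proof. by move=> dd' [e h]; split=> // x xd; apply: h; apply: leq_trans dd'. Qed.

Lemma extends_set d s x v : d <= x -> extends d s (set_reg s x v).
Proof.
by move=> dx; split=> // y yd; rewrite /= /upd ltn_eqF // (leq_trans yd).
Qed.

Definition represents (rs env : seq nat) (s : ram_state) : Prop :=
  [/\ Defs.mem s = M, reg s 0 = n, reg s 1 = k &
      forall i, reg s (nth 0 rs i) = nth n env i].

Lemma represents_extends rs env d s s' :
  1 < d -> all (gtn d) rs -> extends d s s' ->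
  represents rs env s -> represents rs env s'.
Proof.
move=> d1 rsd [em er] [hM h0 h1 hrs]; split; rewrite ?em ?er //; try by lia.
move=> i; rewrite er // ; case: (ltnP i (size rs)) => [ir|ir].
  by move/(all_nthP 0): rsd; apply.
by rewrite nth_default //; lia.
Qed.

Lemma represents_cons rs env x s v :
  reg s x = v -> represents rs env s -> represents (x :: rs) (v :: env) s.
Proof. by move=> sx [hM h0 h1 hrs]; split=> // -[|i] /=. Qed.

(** The target is cleared and then serves as the zero summand, so it has to differ from the
    source. *)
Lemma exec_copy d y s : reg s y < B -> y != d ->
  exists s', [/\ exec B (CCopy d y d) s 2 s', reg s' d = reg s y & extends d s s'].
Proof.
move=> yB yd; exists (set_reg (set_reg s d 0) d (reg s y)); split.
- have e : reg s y = eval_op OpAdd (reg (set_reg s d 0) y) (reg (set_reg s d 0) d).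
    by rewrite /= /upd eqxx (negbTE yd) addn0.
  have E1 : exec B (CConst d 0) s 1 (set_reg s d 0).
    by apply: exec_const; exact: ltnW.
  apply: (exec_seq (t1 := 1) (t2 := 1) E1).
  by rewrite e; apply: exec_op; rewrite -e.
- by rewrite /= /upd eqxx.
- by apply: extends_trans (extends_set _ _ (leqnn d)) (extends_set _ _ (leqnn d)).
Qed.

Lemma all_gtn_leq d d' rs : d <= d' -> all (gtn d) rs -> all (gtn d') rs.
Proof. by move=> dd'; apply: sub_all => x xd; apply: leq_trans dd'. Qed.

Definition runs (c : ram_com) (d : nat) (s : ram_state) (tmax v : nat) : Prop :=
  exists t s', [/\ exec B c s t s', t <= tmax, reg s' d = v & extends d s s'].

(** Structural induction: each subexpression is run at a register above all values still needed, and
    [extends] keeps these intact. *)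
Lemma compile_runs e rs env d s :
  1 < d -> all (gtn d) rs -> represents rs env s -> safe e env ->
  runs (compile rs d e) d s (time_bound n1 H e) (eval e env).
Proof.
have copy y s0 d0 v : y != d0 -> reg s0 y = v -> v < B -> runs (CCopy d0 y d0) d0 s0 2 v.
  move=> yd <- vB; have [s' [E e1 e2]] := exec_copy vB yd.
  by exists 2, s'.
elim: e rs env d s => /=.
- move=> i rs env d s d1 rsd [hM h0 h1 hrs] sf; apply: copy => //.
  case: (ltnP i (size rs)) => [ir|ir]; last by rewrite nth_default //; lia.
  by move/(all_nthP 0): rsd => /(_ _ ir) /= h; rewrite ltn_eqF.
- by move=> rs env d s d1 rsd [hM h0 h1 hrs] sf; apply: copy => //; lia.
- by move=> rs env d s d1 rsd [hM h0 h1 hrs] sf; apply: copy => //; lia.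
- move=> v rs env d s d1 rsd rep sf; exists 1, (set_reg s d v); split=> //.
  + exact: exec_const.
  + by rewrite /= /upd eqxx.
  + exact: extends_set.
- move=> o a IHa b IHb rs env d s d1 rsd rep [sa sb so].
  have [t1 [s1 [E1 l1 v1 x1]]] := IHa _ _ _ _ d1 rsd rep sa.
  have rep1 := represents_extends d1 rsd x1 rep.
  have [t2 [s2 [E2 l2 v2 x2]]] :=
    IHb _ _ _ _ (leqW d1) (all_gtn_leq (leqnSn d) rsd) rep1 sb.
  have vd : reg s2 d = eval a env by rewrite x2.2.
  exists (t1 + (t2 + 1)), (set_reg s2 d (eval_op o (eval a env) (eval b env))).
  split.
  + apply: exec_seq E1 _; apply: exec_seq E2 _.
    by rewrite -{1}vd -{1}v2; apply: exec_op; rewrite vd v2.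
  + by lia.
  + by rewrite /= /upd eqxx.
  + apply: extends_trans x1 _; apply: extends_trans (extends_leq (leqnSn d) x2) _.
    exact: extends_set.
- move=> a IHa rs env d s d1 rsd rep [sa sM].
  have [t1 [s1 [E1 l1 v1 x1]]] := IHa _ _ _ _ d1 rsd rep sa.
  have [hM _ _ _] := represents_extends d1 rsd x1 rep.
  exists (t1 + 1), (set_reg s1 d (M (eval a env))); split.
  + by apply: exec_seq E1 _; rewrite -hM -v1; apply: exec_load; rewrite hM v1.
  + by lia.
  + by rewrite /= /upd eqxx.
  + by apply: extends_trans x1 _; apply: extends_set.
- move=> a IHa b IHb rs env d s d1 rsd rep [sa sb].
  have [t1 [s1 [E1 l1 v1 x1]]] := IHa _ _ _ _ d1 rsd rep sa.
  have rep1 := represents_cons v1 (represents_extends d1 rsd x1 rep).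
  have rsd1 : all (gtn d.+1) (d :: rs) by rewrite /= ltnSn (all_gtn_leq _ rsd).
  have [t2 [s2 [E2 l2 v2 x2]]] := IHb _ _ _ _ (leqW d1) rsd1 rep1 sb.
  have [t3 [s3 [E3 l3 v3 x3]]] :=
    copy d.+1 s2 d _ (negbT (gtn_eqF (ltnSn d))) v2 (safe_eval sb).
  exists (t1 + (t2 + t3)), s3; split=> //; try by lia.
    by apply: exec_seq E1 _; apply: exec_seq E2 _.
  by apply: extends_trans x1 _; apply: extends_trans (extends_leq (leqnSn d) x2) x3.
- move=> a IHa b IHb c IHc rs env d s d1 rsd rep [sa].
  have [t1 [s1 [E1 l1 v1 x1]]] := IHa _ _ _ _ d1 rsd rep sa.
  have rep1 := represents_extends d1 rsd x1 rep.
  case: ifP => [nz sb|/negbFE/eqP z sc].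
  + have [t2 [s2 [E2 l2 v2 x2]]] := IHb _ _ _ _ d1 rsd rep1 sb.
    exists (t1 + t2.+1), s2; split=> //; try by lia.
      by apply: exec_seq E1 _; apply: exec_if_true; rewrite ?v1.
    exact: extends_trans x1 x2.
  + have [t2 [s2 [E2 l2 v2 x2]]] := IHc _ _ _ _ d1 rsd rep1 sc.
    exists (t1 + t2.+1), s2; split=> //; try by lia.
      by apply: exec_seq E1 _; apply: exec_if_false; rewrite ?v1.
    exact: extends_trans x1 x2.
- move=> o x0 poly m IHm b IHb rs env d s d1 rsd rep [sm mle sb sacc].
  have [t1 [s1 [E1 l1 v1 x1]]] := IHm _ _ _ _ d1 rsd rep sm.
  have NB := safe_eval sm.
  set N := eval m env in v1 mle sb sacc NB *.
  set f := fun i acc => eval_op o acc (eval b (i :: env)) in sacc *.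
  set body := CSeq (compile _ d.+4 b) _.
  (* Registers [d] to [d.+3] hold the number of rounds, the counter, the accumulator and the loop
     flag; the induction is on the number [j] of rounds left. *)
  have loop j i s0 : i + j = N -> reg s0 d = N -> reg s0 d.+1 = i ->
      reg s0 d.+2 = iteri i f x0 -> reg s0 d.+3 = (i < N) -> extends d s s0 ->
      exists t s', [/\ exec B (CWhile d.+3 body) s0 t s',
        t <= j * (time_bound n1 H b + 5) + 1, reg s' d.+2 = iteri N f x0 & extends d s s'].
    elim: j i s0 => [|j IHj] i s0 eij r0 r1 r2 r3 xs.
      exists 1, s0; split=> //; last by rewrite -eij addn0.
      by apply: exec_while_end; rewrite r3; lia.
    have iN : i < N by lia.
    have rep0 := represents_cons r1 (represents_extends d1 rsd xs rep).
    have rsd4 : all (gtn d.+4) (d.+1 :: rs).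
      by rewrite /= (all_gtn_leq _ rsd) //; lia.
    have d4 : 1 < d.+4 by [].
    have [t2 [s2 [E2 l2 v2 x2]]] := IHb _ _ _ _ d4 rsd4 rep0 (sb i iN).
    have [q0 q1 q2] : [/\ reg s2 d = N, reg s2 d.+1 = i & reg s2 d.+2 = iteri i f x0].
      by rewrite !x2.2 //; lia.
    pose s3 := set_reg s2 d.+2 (f i (iteri i f x0)).
    pose s4 := set_reg s3 d.+4 1.
    pose s5 := set_reg s4 d.+1 (i + 1).
    pose s6 := set_reg s5 d.+3 (i + 1 < N).
    have updE x y (g : nat -> nat) v : upd g x v y = if y == x then v else g y by [].
    have E3 : exec B (COp o d.+2 d.+2 d.+4) s2 1 s3.
      rewrite /s3 /f -{1}v2 -{1}q2; apply: exec_op.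
      by rewrite q2 v2; apply: (sacc i.+1).
    have E4 : exec B (CConst d.+4 1) s3 1 s4 by apply: exec_const.
    have p4 : reg s4 d.+1 = i /\ reg s4 d.+4 = 1.
      by rewrite /= !updE !eqSS eqxx q1; do !case: eqP => [?|_] //; lia.
    have E5 : exec B (COp OpAdd d.+1 d.+1 d.+4) s4 1 s5.
      have e : i + 1 = eval_op OpAdd (reg s4 d.+1) (reg s4 d.+4).
        by rewrite /eval_op p4.1 p4.2.
      by rewrite /s5 e; apply: exec_op; rewrite -e; lia.
    have p5 : reg s5 d.+1 = i + 1 /\ reg s5 d = N.
      rewrite /= !updE eqxx q0; split=> //.
      by do !case: eqP => [?|_] //; lia.
    have E6 : exec B (COp OpLt d.+3 d.+1 d) s5 1 s6.
      have e : nat_of_bool (i + 1 < N) = eval_op OpLt (reg s5 d.+1) (reg s5 d).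
        by rewrite p5.1 p5.2.
      rewrite /s6 e; apply: exec_op; rewrite -e.
      by case: (_ < N) => //; exact: ltnW.
    have Eb : exec B body s0 (t2 + (1 + (1 + (1 + 1)))) s6.
      by apply: exec_seq E2 _; apply: exec_seq E3 _; apply: exec_seq E4 _;
         apply: exec_seq E5 E6.
    have x6 : extends d s s6.
      apply: extends_trans xs _.
      apply: extends_trans (extends_leq _ x2) _; first by lia.
      do 3![apply: (@extends_trans _ _ (set_reg _ _ _)); last by apply: extends_set; lia].
      by apply: extends_set; lia.
    have [t7 [s7 [E7 l7 v7 x7]]] : exists t s', [/\ exec B (CWhile d.+3 body) s6 t s',
        t <= j * (time_bound n1 H b + 5) + 1, reg s' d.+2 = iteri N f x0 & extends d s s'].
      apply: (IHj i.+1) => //; first by lia.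
      - by rewrite /= !updE q0; do !case: eqP => [?|_] //; lia.
      - by rewrite /= !updE eqxx addn1; do !case: eqP => [?|_] //; lia.
      - by rewrite /= !updE eqxx; do !case: eqP => [?|_] //; lia.
      - by rewrite /= !updE eqxx addn1.
    exists (t2 + (1 + (1 + (1 + 1))) + t7).+1, s7; split=> //; last by lia.
    by apply: exec_while_step Eb E7; rewrite r3 iN.
  pose s2 := set_reg s1 d.+1 0.
  pose s3 := set_reg s2 d.+2 x0.
  pose s4 := set_reg s3 d.+3 (0 < N).
  have E2 : exec B (CConst d.+1 0) s1 1 s2 by apply: exec_const; exact: ltnW.
  have E3 : exec B (CConst d.+2 x0) s2 1 s3 by apply: exec_const; apply: (sacc 0).
  have updE x y (g : nat -> nat) v : upd g x v y = if y == x then v else g y by [].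
  have p3 : reg s3 d.+1 = 0 /\ reg s3 d = N.
    by rewrite /= !updE eqxx v1; do !case: eqP => [?|_] //; lia.
  have E4 : exec B (COp OpLt d.+3 d.+1 d) s3 1 s4.
    have e : nat_of_bool (0 < N) = eval_op OpLt (reg s3 d.+1) (reg s3 d).
      by rewrite p3.1 p3.2.
    rewrite /s4 e; apply: exec_op; rewrite -e.
    by case: (0 < N) => //; exact: ltnW.
  have x4 : extends d s s4.
    apply: extends_trans x1 _.
    do 2![apply: (@extends_trans _ _ (set_reg _ _ _)); last by apply: extends_set; lia].
    by apply: extends_set; lia.
  have [t5 [s5 [E5 l5 v5 x5]]] : exists t s', [/\ exec B (CWhile d.+3 body) s4 t s',
        t <= N * (time_bound n1 H b + 5) + 1, reg s' d.+2 = iteri N f x0 & extends d s s'].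
    apply: (loop N 0) => //.
    - by rewrite /= !updE v1; do !case: eqP => [?|_] //; lia.
    - by rewrite /= !updE eqxx; do !case: eqP => [?|_] //; lia.
    - by rewrite /= !updE eqxx; do !case: eqP => [?|_] //; lia.
    - by rewrite /= !updE eqxx.
  have [t6 [s6 [E6 l6 v6 x6]]] := copy d.+2 s5 d _ (negbT (gtn_eqF (leqnSn d.+1))) v5
    (sacc N (leqnn N)).
  exists (t1 + (1 + (1 + (1 + (t5 + t6))))), s6; split=> //.
  + by apply: exec_seq E1 _; apply: exec_seq E2 _; apply: exec_seq E3 _;
       apply: exec_seq E4 _; apply: exec_seq E5 E6.
  + have := leq_mul mle (leqnn (time_bound n1 H b + 5)); lia.
  + exact: extends_trans x5 x6.
Qed.

End Compilation.

(** * Interval assignments and the kernel *)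

Section Separation.
Variables (X : finType) (N : rel X).
Implicit Types (E : X -> Prop) (lo hi : X -> nat -> nat).

Definition separated lo hi (e f : X) (i : nat) : bool :=
  (hi e i < lo f i) || (hi f i < lo e i).

(** Imposed also for [e = f], the equation forces [lo e i <= hi e i] for members [e] and [i < k] as
    soon as [N] is irreflexive, so the intervals are nonempty. *)
Definition separable E (k : nat) : Prop :=
  exists lo hi, forall e f, E e -> E f ->
    N e f = has (separated lo hi e f) (iota 0 k).

Lemma separatedC lo hi e f : separated lo hi e f =1 separated lo hi f e.
Proof. by move=> i; rewrite /separated orbC. Qed.

Lemma separable_sub E E' k :
  (forall e, E' e -> E e) -> separable E k -> separable E' k.
Proof. by move=> EE' [lo [hi h]]; exists lo, hi => e f /EE' He /EE' Hf; apply: h. Qed.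

(** In the added coordinates every interval is [[0, 0]], which separates nothing. *)
Lemma separable_leq E d k : d <= k -> separable E d -> separable E k.
Proof.
move=> dk [lo [hi h]].
pose cut (g : X -> nat -> nat) e i := if i < d then g e i else 0.
exists (cut lo), (cut hi) => e f Ee Ef.
rewrite (h _ _ Ee Ef) -(subnKC dk) iotaD has_cat.
rewrite [X in _ || X](_ : _ = false) ?orbF.
  by apply: eq_in_has => i; rewrite mem_iota /= => id; rewrite /separated /cut id.
apply/negbTE/hasPn => i; rewrite mem_iota add0n => /andP[di _].
by rewrite /separated /cut [i < d]ltnNge di.
Qed.

Lemma separable_isolated E k a :
  symmetric N -> (forall f, E f \/ f = a -> ~~ N a f) ->
  separable E k -> separable (fun f => f = a \/ E f) k.
Proof.
move=> Nsym Na [lo [hi h]].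
pose lo' e i := if e == a then 0 else lo e i.
pose hi' e i := if e == a then \max_f lo f i else hi e i.
have sepa f i : separated lo' hi' a f i = false.
  rewrite /separated /lo' /hi' eqxx orbF.
  by case: eqP => //= _; apply/negbTE; rewrite -leqNgt leq_bigmax.
exists lo', hi' => e f Ee Ef.
have [->|ea] := eqVneq e a.
  by rewrite (negbTE (Na f _)) ?(eq_has (sepa f)) ?has_pred0 //; case: Ef; auto.
have [->|fa] := eqVneq f a.
  rewrite Nsym (negbTE (Na e _)); last by case: Ee; auto.
  by rewrite (eq_has (separatedC _ _ _ _)) (eq_has (sepa e)) has_pred0.
case: Ee ea => [->|Ee ea]; first by rewrite eqxx.
case: Ef fa => [->|Ef fa]; first by rewrite eqxx.
rewrite (h _ _ Ee Ef); apply: eq_has => i.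
by rewrite /separated /lo' /hi' (negbTE ea) (negbTE fa).
Qed.

(* In a coordinate where e1 lies left of e2, every member outside the clique C
   contains the gap between them, so a can be put in the gap once the members
   of C that reach across its left end r have been cut off at r. *)
Lemma separable_add_twin E (C : pred X) k a e1 e2 :
  symmetric N -> irreflexive N ->
  (forall f, E f -> f != a -> N a f = C f) ->
  (forall f g, E f -> E g -> C f -> C g -> f != g -> N f g) ->
  (forall f, E f -> ~~ C f -> ~~ N f e1 && ~~ N f e2) ->
  E e1 -> E e2 -> N e1 e2 ->
  separable E k -> separable (fun f => f = a \/ E f) k.
Proof.
move=> Nsym Nirr Na Ncl Nout E1 E2 N12 [lo [hi h]].
(* [r] is the right end of whichever of [e1], [e2] lies to the left in coordinate [i]; a member
   separated from neither starts at [r] or before and ends after [r]. *)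
have {E1 E2 N12 Nout} [i0 [r [ik rout]]] : exists i r, i < k /\
    forall f, E f -> ~~ C f -> (lo f i <= r) && (r < hi f i).
  have := h _ _ E1 E2; rewrite N12 => /esym/hasP[i].
  rewrite mem_iota /= => ik /orP sep; exists i.
  have nsep e f : E e -> E f -> ~~ N e f -> ~~ separated lo hi e f i.
    by move=> Ee Ef; rewrite (h _ _ Ee Ef) => /hasPn; apply; rewrite mem_iota.
  case: sep => lt12; [exists (hi e1 i)|exists (hi e2 i)]; split=> // f Ef Cf.
    have /andP[/(nsep _ _ Ef E1) s1 /(nsep _ _ Ef E2) s2] := Nout _ Ef Cf.
    by move: s1 s2; rewrite /separated; lia.
  have /andP[/(nsep _ _ Ef E1) s1 /(nsep _ _ Ef E2) s2] := Nout _ Ef Cf.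
  by move: s1 s2; rewrite /separated; lia.
pose cutf f := [&& C f, lo f i0 <= r & r < hi f i0].
(* Left ends go to [4 * x] and right ends to [4 * x + 2]. This keeps all comparisons of a right end
   with a left end and frees [4 * r + 3] for [a], after all right ends up to [r] and before all left
   ends beyond [r]. *)
pose lo' f i := if f == a then if i == i0 then 4 * r + 3 else 0 else 4 * lo f i.
pose hi' f i :=
  if f == a then if i == i0 then 4 * r + 3 else 4 * \max_g lo g i
  else if (i == i0) && cutf f then 4 * r + 2 else 4 * hi f i + 2.
have sepa f : E f -> f != a -> N a f = has (separated lo' hi' a f) (iota 0 k).
  move=> Ef fa; rewrite (Na _ Ef fa).
  have [Cf|nCf] := boolP (C f).
    apply/esym/hasP; exists i0; first by rewrite mem_iota.
    rewrite /separated /lo' /hi' !eqxx (negbTE fa) /cutf Cf /=.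
    by case: ifP; lia.
  apply/esym/negbTE/hasPn => i _; rewrite /separated /lo' /hi' eqxx (negbTE fa).
  have := rout _ Ef nCf; rewrite /cutf (negbTE nCf) andbF.
  case: eqP => [->|_ _]; first by lia.
  by have := leq_bigmax (F := fun g => lo g i) f; lia.
have sepaa : has (separated lo' hi' a a) (iota 0 k) = false.
  apply/negbTE/hasPn => i _; rewrite /separated /lo' /hi' eqxx.
  by case: eqP; rewrite ?ltnn.
exists lo', hi' => e f Ee Ef.
have [->|ea] := eqVneq e a.
  have [->|fa] := eqVneq f a; first by rewrite Nirr sepaa.
  by case: Ef fa => [->|Ef fa]; [rewrite eqxx|apply: sepa].
case: Ee ea => [->|Ee ea]; first by rewrite eqxx.
have [->|fa] := eqVneq f a.
  by rewrite Nsym (eq_has (separatedC _ _ _ _)); apply: sepa.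
case: Ef fa => [->|Ef fa]; first by rewrite eqxx.
have sepE i : i != i0 -> separated lo' hi' e f i = separated lo hi e f i.
  move=> ii0; rewrite /separated /lo' /hi' (negbTE ea) (negbTE fa) (negbTE ii0) /=.
  by lia.
apply/idP/hasP => [|[i ir]].
  rewrite (h _ _ Ee Ef) => /hasP[i ir sep]; exists i => //.
  have [ii0|ii0] := eqVneq i i0; last by rewrite sepE.
  move: sep; rewrite ii0 /separated /lo' /hi' (negbTE ea) (negbTE fa) eqxx /cutf /=.
  by do 2!case: ifP; lia.
have [ii0|ii0] := eqVneq i i0; last first.
  by rewrite sepE // (h _ _ Ee Ef) => sep; apply/hasP; exists i.
(* A member cut at [r] becomes newly separated only from members starting after [r]. These belong to
   [C], so the new separations stay within the clique. *)
have cross g g' : E g -> E g' -> g != a -> g' != a -> hi' g i < lo' g' i -> N g g'.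
  move=> Eg Eg' ga g'a; rewrite ii0 /lo' /hi' (negbTE ga) (negbTE g'a) eqxx /=.
  case: ifP => [/and3P[Cg lg rg] lt|_ lt].
    have [Cg'|nCg'] := boolP (C g'); last by have := rout _ Eg' nCg'; lia.
    by apply: Ncl => //; apply/eqP => egg; rewrite -egg in lt; lia.
  rewrite (h _ _ Eg Eg'); apply/hasP; exists i0; first by rewrite -ii0.
  by rewrite /separated; lia.
by case/orP => lt; [|rewrite Nsym]; apply: cross lt.
Qed.

End Separation.

(** * Adjacency in the line graph and the size of the core *)

Definition meets (T : finType) (e f : {set T}) : bool :=
  (e != f) && (e :&: f != set0).

Section Edges.
Variables (T : finType) (G : sgraph T).

Lemma meets_sym : symmetric (@meets T).
Proof. by move=> e f; rewrite /meets eq_sym setIC. Qed.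

Lemma meets_irr : irreflexive (@meets T).
Proof. by move=> e; rewrite /meets eqxx. Qed.

Lemma meetsP (e f : {set T}) :
  reflect (e != f /\ exists2 x, x \in e & x \in f) (meets e f).
Proof.
apply: (iffP andP) => -[ef].
  by case/set0Pn => x /setIP[xe xf]; split=> //; exists x.
by case=> x xe xf; split=> //; apply/set0Pn; exists x; apply/setIP.
Qed.

Definition induced_edge (S : pred T) (e : {set T}) : Prop :=
  exists u v, [/\ S u, S v, G u v & e = [set u; v]].

Lemma adj_neq u v : G u v -> u != v.
Proof. by case: eqP => // ->; rewrite adj_irr. Qed.

(* Let e_x, f_x be the separated edges at x. The vertices of e_v and f_w, where
   e_v ends first and f_w starts last, form a set of size at most 4; the edges e_x, f_x of any other centre x join it to this
   set, and two centres cannot be joined to it in the same way. *)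
Lemma card_centers (lo hi : {set T} -> nat) (C : {set T}) :
  (forall e f, induced_edge predT e -> induced_edge predT f ->
     hi e < lo f -> meets e f) ->
  (forall v, v \in C -> exists p q,
     [/\ G v p, G v q & hi [set v; p] < lo [set v; q]]) ->
  #|C| <= 8.
Proof.
move=> sepm cen.
have /fin_all_exists[g gP] v : exists x : T * T, v \in C ->
    [/\ G v x.1, G v x.2 & hi [set v; x.1] < lo [set v; x.2]].
  case: (boolP (v \in C)) => [vC|_]; last by exists (v, v).
  by have [p [q h]] := cen v vC; exists (p, q).
pose p v := (g v).1; pose q v := (g v).2.
pose e v := [set v; p v]; pose f v := [set v; q v].
have Ee v : v \in C -> induced_edge predT (e v).
  by move=> vC; exists v, (p v); split=> //; case: (gP v vC).
have Ef v : v \in C -> induced_edge predT (f v).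
  by move=> vC; exists v, (q v); split=> //; case: (gP v vC).
have ef v : v \in C -> hi (e v) < lo (f v) by move=> vC; case: (gP v vC).
have cross v w : v \in C -> w \in C -> hi (e v) < lo (f w) ->
    [|| v == w, v == q w, p v == w | p v == q w].
  move=> vC wC lt; have /meetsP[_ [x]] := sepm _ _ (Ee v vC) (Ef w wC) lt.
  rewrite !inE => /orP[/eqP->|/eqP->] /orP[/eqP->|/eqP->]; by rewrite eqxx ?orbT.
have pq v : v \in C -> p v != q v.
  move=> vC; apply/eqP => epq; have lt := ef v vC.
  have := sepm _ _ (Ee v vC) (Ef v vC) lt.
  by rewrite /e /f epq meets_irr.
have [->|[v0 v0C]] := set_0Vmem C; first by rewrite cards0.
have [a aC amin] := arg_minnP (fun v => hi (e v)) v0C.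
have [b bC bmax] := arg_maxnP (fun v => lo (f v)) v0C.
pose Z := [set a; p a] :|: [set b; q b].
have cZ : #|Z| <= 4.
  by apply: leq_trans (leq_card_setU _ _) _; rewrite !cards2; do 2!case: eqP.
have inZ x : x \in C -> x \notin Z -> (p x == b) || (p x == q b).
  move=> xC xZ; have lt : hi (e x) < lo (f b) by apply: leq_trans (ef x xC) (bmax _ xC).
  have := cross _ _ xC bC lt; move: xZ; rewrite !inE.
  by case/norP => _ /norP[/negbTE -> /negbTE ->].
have inZ' x : x \in C -> x \notin Z -> (q x == a) || (q x == p a).
  move=> xC xZ; have lt : hi (e a) < lo (f x) by apply: leq_ltn_trans (amin _ xC) (ef x xC).
  have := cross _ _ aC xC lt; move: xZ; rewrite !inE.
  case/norP => /norP[/negbTE xa /negbTE xp] _.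
  by rewrite (eq_sym a x) (eq_sym a) (eq_sym (p a)) (eq_sym (p a)) xa xp /=.
have cD : #|C :\: Z| <= 4.
  (* Two Boolean choices fix [p x] in [{b, q b}] and [q x] in [{a, p a}], so injectivity of [h]
     bounds the centres outside [Z] by 4. *)
  pose h x := (p x == b, q x == a).
  have hinj : {in C :\: Z &, injective h}.
    move=> x y /setDP[xC xZ] /setDP[yC yZ] [ep eq].
    have pp : p x = p y.
      move: ep (inZ x xC xZ) (inZ y yC yZ).
      by case: (eqVneq (p x) b) (eqVneq (p y) b) => [->|_] [->|_] //= _ /eqP-> /eqP->.
    have qq : q x = q y.
      move: eq (inZ' x xC xZ) (inZ' y yC yZ).
      by case: (eqVneq (q x) a) (eqVneq (q y) a) => [->|_] [->|_] //= _ /eqP-> /eqP->.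
    have pZ : p x \in Z by have := inZ x xC xZ; rewrite !inE => /orP[->|->]; rewrite !orbT.
    have qZ : q x \in Z by have := inZ' x xC xZ; rewrite !inE => /orP[->|->]; rewrite ?orbT.
    (* The edge [e v] ends before [f w] starts, so the two share a vertex; membership in [Z] and
       [p w != q w] leave only [v = w]. *)
    have key v w : v \in C -> w \in C -> v \notin Z -> w \notin Z ->
        p v \in Z -> q w \in Z -> p v = p w -> hi (e v) <= hi (e w) -> v = w.
      move=> vC wC vZ wZ pvZ qwZ epv le.
      have := cross _ _ vC wC (leq_ltn_trans le (ef w wC)).
      case/or4P => /eqP // E.
      - by rewrite E qwZ in vZ.
      - by rewrite -E pvZ in wZ.
      - by have := pq w wC; rewrite -epv E eqxx.
    have [le|/ltnW le] := leqP (hi (e x)) (hi (e y)); first by apply: key le => //; rewrite -qq.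
    by apply/esym; apply: key le => //; rewrite -pp.
  rewrite -(card_in_imset hinj).
  by apply: leq_trans (max_card _) _; rewrite card_prod card_bool.
rewrite -(cardsID Z C).
by apply: leq_trans (leq_add (subset_leq_card (subsetIr _ _)) cD) _; lia.
Qed.

Definition core (v : T) : bool := 1 < #|[pred w | G v w]|.

Lemma card_bigcup_le (I : finType) (A : {set I}) (F : I -> {set T}) m :
  (forall i, i \in A -> #|F i| <= m) -> #|\bigcup_(i in A) F i| <= #|A| * m.
Proof.
move=> Fm; rewrite -sum_nat_const.
elim/big_rec2: _ => [|i s B iA IH]; first by rewrite cards0.
by apply: leq_trans (leq_card_setU _ _) _; apply: leq_add => //; apply: Fm.
Qed.

(** Two edges at a core vertex meet, so some coordinate separates them and the vertex is a centre
    there; each coordinate has at most 8 centres by [card_centers]. *)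
Lemma card_core k :
  separable (@meets T) (induced_edge predT) k -> #|[set v | core v]| <= k * 8.
Proof.
case=> lo [hi h].
pose C (i : 'I_k) := [set v | [exists p, exists q,
  [&& G v p, G v q & hi [set v; p] i < lo [set v; q] i]]].
apply: (@leq_trans #|\bigcup_(i in [set: 'I_k]) C i|).
  apply: subset_leq_card; apply/subsetP => v; rewrite inE => /card_gt1P[p [q []]].
  rewrite !inE => vp vq npq.
  have Ep : induced_edge predT [set v; p] by exists v, p.
  have Eq : induced_edge predT [set v; q] by exists v, q.
  have : meets [set v; p] [set v; q].
    apply/meetsP; split; last by exists v; rewrite !inE eqxx.
    apply/eqP => /setP /(_ p); rewrite !inE eqxx orbT (negbTE npq) orbF.
    by rewrite eq_sym (negbTE (adj_neq vp)).
  rewrite (h _ _ Ep Eq) => /hasP[i]; rewrite mem_iota /= => ik sep.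
  apply/bigcupP; exists (Ordinal ik); rewrite inE //.
  case/orP: sep => lt; apply/existsP.
    by exists p; apply/existsP; exists q; rewrite vp vq.
  by exists q; apply/existsP; exists p; rewrite vp vq.
rewrite -[X in _ <= X * _]card_ord -cardsT; apply: card_bigcup_le => i _.
apply: (@card_centers (fun e => lo e i) (fun e => hi e i)) => [e f Ee Ef lt|v].
  rewrite (h _ _ Ee Ef); apply/hasP; exists (val i); first by rewrite mem_iota /=.
  by rewrite /separated lt.
by rewrite inE => /existsP[p /existsP[q /and3P[? ? ?]]]; exists p, q.
Qed.

End Edges.

(** * The kernel: the core with at most two leaves per core vertex *)

Section Kernel.
Variables (n : nat) (G : sgraph 'I_n).

(** Neighbours of [u] outside the core are its leaves; counting those that precede [v] singles out
    the first two without storing a list. *)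
Definition leaf_rank (u v : 'I_n) : nat :=
  #|[pred w : 'I_n | [&& w < v, G u w & ~~ core G w]]|.

Definition kept (v : 'I_n) : bool :=
  core G v || [exists u, [&& G u v, core G u & leaf_rank u v < 2]].

(** [leaf_rank u] increases strictly along the leaves at [u], so each of the values 0 and 1 is taken
    at most once. *)
Lemma card_leaf_rank (u : 'I_n) :
  #|[set v : 'I_n | [&& G u v, ~~ core G v & leaf_rank u v < 2]]| <= 2.
Proof.
set A := [set v | _].
have h_inj : {in A &, injective (fun v => leaf_rank u v == 0)}.
  have lt (v w : 'I_n) : v \in A -> w \in A -> v < w -> leaf_rank u v < leaf_rank u w.
    rewrite !inE => /and3P[uv nv _] _ vw; apply: proper_card.
    rewrite properE; apply/andP; split; apply/subsetP.
      by move=> x; rewrite !inE => /and3P[xv -> ->]; rewrite (ltn_trans xv vw).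
    by move/(_ v); rewrite !inE vw uv nv ltnn => /(_ isT).
  move=> v w vA wA; case: (ltngtP v w) => [vw|vw|/val_inj //].
    by move: (lt _ _ vA wA vw) (wA); rewrite !inE => l /and3P[_ _ l2]; lia.
  by move: (lt _ _ wA vA vw) (vA); rewrite !inE => l /and3P[_ _ l2]; lia.
rewrite -(card_in_imset h_inj).
by apply: leq_trans (max_card _) _; rewrite card_bool.
Qed.

Lemma card_kept k :
  separable (@meets _) (induced_edge G predT) k -> #|[set v | kept v]| <= 24 * k.
Proof.
move/card_core => ck.
pose F u := u |: [set v : 'I_n | [&& G u v, ~~ core G v & leaf_rank u v < 2]].
apply: (@leq_trans #|\bigcup_(u in [set v | core G v]) F u|).
  apply: subset_leq_card; apply/subsetP => v; rewrite inE => kv.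
  have [cv|ncv] := boolP (core G v).
    by apply/bigcupP; exists v; rewrite !inE ?eqxx.
  move: kv; rewrite /kept (negbTE ncv) /= => /existsP[u /and3P[uv cu l2]].
  by apply/bigcupP; exists u; rewrite !inE // uv ncv l2 orbT.
apply: (@leq_trans (#|[set v | core G v]| * 3)); last first.
  by apply: leq_trans (leq_mul ck (leqnn 3)) _; lia.
apply: card_bigcup_le => u _.
by rewrite /F cardsU1 -[3]/(1 + 2) leq_add ?leq_b1 ?card_leaf_rank.
Qed.

(** The missing vertices are put back in increasing order. A vertex [z] outside the kernel has at
    most one neighbour, hence brings at most one edge: an isolated one, or a leaf edge at a core
    vertex with two earlier leaves. *)
Lemma separable_kept k :
  separable (@meets _) (induced_edge G kept) k ->
  separable (@meets _) (induced_edge G predT) k.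
Proof.
move=> sk; pose S j (v : 'I_n) := kept v || (v < j).
suff all j : j <= n -> separable (@meets _) (induced_edge G (S j)) k.
  apply: separable_sub (all n (leqnn n)) => e [u [v [_ _ uv ->]]].
  by exists u, v; split=> //; rewrite /S ltn_ord orbT.
elim: j => [_|j IHj jn].
  apply: separable_sub sk => e [u [v [Su Sv uv ->]]].
  by exists u, v; move: Su Sv; rewrite /S !ltn0 !orbF.
have {IHj} := IHj (ltnW jn).
pose z := Ordinal jn.
have Sz (v : 'I_n) : S j.+1 v -> v = z \/ S j v.
  case/orP => [kv|]; first by right; rewrite /S kv.
  rewrite ltnS leq_eqVlt => /orP[/eqP ev|lt]; last by right; rewrite /S lt orbT.
  by left; apply: val_inj.
have [kz|nkz] := boolP (kept z).
  apply: separable_sub => e [u [v [Su Sv uv ->]]]; exists u, v; split=> //.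
    by case: (Sz _ Su) => [->|//]; rewrite /S kz.
  by case: (Sz _ Sv) => [->|//]; rewrite /S kz.
have ncz : ~~ core G z by apply: contra nkz; rewrite /kept => ->.
have deg1 (v x y : 'I_n) : ~~ core G v -> G v x -> G v y -> x = y.
  move=> ncv vx vy; apply/eqP; apply: contraNT ncv => nxy.
  by apply/card_gt1P; exists x, y.
have new a : (forall u, G z u -> S j u -> a = [set z; u]) ->
    separable (@meets _) (fun e => e = a \/ induced_edge G (S j) e) k ->
    separable (@meets _) (induced_edge G (S j.+1)) k.
  move=> ha; apply: separable_sub => e [u [v [Su Sv uv ->]]].
  case: (Sz _ Su) (Sz _ Sv) => [eu|Su'] [ev|Sv'].
  - by move: uv; rewrite eu ev adj_irr.
  - by left; rewrite eu (ha v) // -eu.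
  - by left; rewrite ev (ha u) -?ev 1?adj_sym // setUC.
  - by right; exists u, v.
(* With no neighbour of [z] present no edge appears, and the empty set, which meets nothing, stands
   in for the new member. *)
have [u /andP[zu Su]|none] := pickP (fun u => G z u && S j u); last first.
  move=> sj; apply: (new set0) => [u zu Su|]; first by have := none u; rewrite zu Su.
  apply: separable_isolated sj; first exact: meets_sym.
  by move=> f _; rewrite /meets set0I eqxx andbF.
have Su1 (v : 'I_n) : G z v -> v = u by move=> zv; apply: deg1 zv zu.
have zNE e : induced_edge G (S j) e -> z \notin e.
  have nSz : ~~ S j z by rewrite /S (negbTE nkz) /= ltnn.
  case=> x [y [Sx Sy xy ->]]; rewrite !inE.
  by apply/norP; split; apply/eqP => ez; move: nSz; rewrite ez ?Sx ?Sy.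
move=> sj; apply: (new [set z; u]) => [v /Su1 -> //|].
(* If [u] is outside the core, [z] is its only neighbour and the edge is a component of its own. *)
have [cu|ncu] := boolP (core G u); last first.
  apply: separable_isolated sj; first exact: meets_sym.
  move=> f [Ef|->]; last by rewrite meets_irr.
  apply/negP => /meetsP[_ [x]]; rewrite !inE => /orP[/eqP->|/eqP->] xf.
    by rewrite (negbTE (zNE f Ef)) in xf.
  case: Ef (zNE f Ef) xf => x' [y [_ _ xy ->]]; rewrite !inE => /norP[zx zy].
  case/orP => /eqP eu.
    have : z = y by apply: (deg1 u) => //; [rewrite adj_sym|rewrite eu].
    by move/eqP; rewrite (negbTE zy).
  have : z = x' by apply: (deg1 u) => //; [rewrite adj_sym|rewrite eu adj_sym].
  by move/eqP; rewrite (negbTE zx).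
have : ~~ (leaf_rank u z < 2).
  apply: contra nkz => l2; rewrite /kept; apply/orP; right.
  by apply/existsP; exists u; rewrite adj_sym zu cu l2.
rewrite -leqNgt => /card_gt1P[w1 [w2 []]].
rewrite !inE => /and3P[w1z uw1 nc1] /and3P[w2z uw2 nc2] nw12.
(* An edge through the leaf [w] also contains [u], its only neighbour. *)
have leafout (w : 'I_n) f : G u w -> ~~ core G w -> induced_edge G (S j) f -> u \notin f ->
    ~~ meets f [set u; w].
  move=> uw ncw [x [y [_ _ xy ->]]]; rewrite !inE => /norP[ux uy].
  apply/negP => /meetsP[_ [t]]; rewrite !inE => tf /orP[] /eqP et; move: tf; rewrite et.
    by rewrite (negbTE ux) (negbTE uy).
  case/orP => /eqP ew.
    have : u = y by apply: (deg1 w) => //; [rewrite adj_sym|rewrite ew].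
    by move/eqP; rewrite (negbTE uy).
  have : u = x by apply: (deg1 w) => //; [rewrite adj_sym|rewrite ew adj_sym].
  by move/eqP; rewrite (negbTE ux).
(* The clique consists of the edges through [u]; [w1] and [w2] precede [z], so their edges are
   present and supply the gap. *)
apply: (@separable_add_twin _ _ _ [pred f : {set 'I_n} | u \in f] _ _
          [set u; w1] [set u; w2]) sj.
- exact: meets_sym.
- exact: meets_irr.
- move=> f Ef fa /=; apply/idP/idP => [|uf].
    apply: contraLR => uf; rewrite meets_sym setUC.
    by apply: leafout => //; rewrite adj_sym.
  apply/meetsP; split; first by rewrite eq_sym.
  by exists u; rewrite // !inE eqxx orbT.
- by move=> f g _ _ /= uf ug nfg; apply/meetsP; split=> //; exists u.
- by move=> f Ef /= uf; rewrite !leafout.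
- by exists u, w1; split=> //; rewrite /S w1z orbT.
- by exists u, w2; split=> //; rewrite /S w2z orbT.
- apply/meetsP; split; last by exists u; rewrite !inE eqxx.
  apply/eqP => /setP /(_ w1); rewrite !inE eqxx orbT (negbTE nw12) orbF.
  by rewrite eq_sym (negbTE (adj_neq uw1)).
Qed.

(** Separability entails the size bound, so the bound can be tested first and then limits the search
    in terms of [k] alone. *)
Lemma separable_kernel k :
  separable (@meets _) (induced_edge G predT) k <->
  #|[set v | kept v]| <= 24 * k /\ separable (@meets _) (induced_edge G kept) k.
Proof.
split=> [s|[_]]; last exact: separable_kept.
split; first exact: card_kept.
by apply: separable_sub s => e [u [v [_ _ uv ->]]]; exists u, v.
Qed.

End Kernel.

(** * Boxicity *)

Section Compression.
Import Order.TTheory.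
Variables (d : Order.disp_t) (R : orderType d) (X : finType) (A : {set X}) (hi : X -> R).

(* Replacing an endpoint by the number of intervals that end before it keeps
   all comparisons between right and left endpoints. *)
Definition endpoint_rank (z : R) : nat := #|[set g in A | (hi g < z)%O]|.

Lemma endpoint_rank_lt x z :
  x \in A -> (endpoint_rank (hi x) < endpoint_rank z) = (hi x < z)%O.
Proof.
move=> xA; case: ltP => xz.
  apply: proper_card; rewrite properE; apply/andP; split; apply/subsetP.
    by move=> g; rewrite !inE => /andP[-> gx]; apply: lt_trans xz.
  by move/(_ x); rewrite !inE xA xz ltxx => /(_ isT).
apply/negbTE; rewrite -leqNgt; apply: subset_leq_card; apply/subsetP => g.
by rewrite !inE => /andP[-> gz]; apply: lt_le_trans xz.
Qed.

(** [x] itself is not counted. This strict bound makes ranks usable as digits. *)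
Lemma endpoint_rank_max x z : x \in A -> (z <= hi x)%O -> endpoint_rank z < #|A|.
Proof.
move=> xA zx; apply: proper_card; rewrite properE; apply/andP; split; apply/subsetP.
  by move=> g; rewrite inE => /andP[].
by move/(_ x xA); rewrite inE ltNge zx andbF.
Qed.

End Compression.

(** * Boxicity in terms of separated intervals *)

Section Boxes.
Variable R : realType.
Import Order.TTheory GRing.Theory Num.Theory.

Lemma closed_box_meet d (lo hi lo' hi' : 'rV[R]_d) :
  (forall i, lo ord0 i <= hi ord0 i)%R -> (forall i, lo' ord0 i <= hi' ord0 i)%R ->
  classical_sets.nonempty (classical_sets.setI (closed_box lo hi) (closed_box lo' hi')) <->
  forall i, (lo ord0 i <= hi' ord0 i)%R && (lo' ord0 i <= hi ord0 i)%R.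
Proof.
move=> h h'; split=> [[p [hp hp']] i|H].
  have /andP[l1 l2] := hp i; have /andP[l1' l2'] := hp' i.
  by rewrite (le_trans l1 l2') (le_trans l1' l2).
exists (\row_i Num.max (lo ord0 i) (lo' ord0 i))%R; split=> i;
  have /andP[l1 l2] := H i; rewrite !mxE le_max ge_max lexx ?orbT /= ?h ?h' ?l1 ?l2 //.
Qed.

(** Real endpoints turn into ranks in one direction, naturals into reals in the other, where the
    case [x = y] of separability gives nonempty boxes. *)
Lemma box_representable_separable (X : finType) (H : sgraph X) d :
  box_representable R H d <->
  separable (fun x y => (x != y) && ~~ H x y) (fun=> True) d.
Proof.
split=> [[lo [hi [lohi h]]]|[lo [hi h]]].
- pose rk (j : 'I_d) := endpoint_rank [set: X] (fun g => hi g ord0 j).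
  pose nt (c : X -> 'rV[R]_d) x (i : nat) :=
    if insub i is Some j then rk j (c x ord0 j) else 0.
  have cmp (j : 'I_d) x y : (nt hi x j < nt lo y j) = (hi x ord0 j < lo y ord0 j)%R.
    by rewrite /nt valK /rk (endpoint_rank_lt (fun g => hi g ord0 j)) // inE.
  exists (nt lo), (nt hi) => x y _ _.
  have sepE (j : 'I_d) : separated (nt lo) (nt hi) x y j =
      ~~ ((lo x ord0 j <= hi y ord0 j)%R && (lo y ord0 j <= hi x ord0 j)%R).
    by rewrite /separated !cmp negb_and -!ltNge orbC.
  have [<-|xy] /= := eqVneq x y.
    apply/esym/negbTE/hasPn => i; rewrite mem_iota /= => id.
    by rewrite -[i]/(val (Ordinal id)) /separated !cmp orbb -leNgt lohi.
  apply/idP/hasP => [nH|[i]].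
    have : ~ classical_sets.nonempty
        (classical_sets.setI (closed_box (lo x) (hi x)) (closed_box (lo y) (hi y))).
      by move/(h _ _ xy); apply/negP.
    rewrite closed_box_meet // => nall.
    have /existsP[j nj] : [exists j : 'I_d, separated (nt lo) (nt hi) x y j].
      apply: contra_notT nall => /existsPn nex j.
      by have := nex j; rewrite sepE negbK.
    by exists (val j) => //; rewrite mem_iota /=.
  rewrite mem_iota /= => id; rewrite -[i]/(val (Ordinal id)) sepE => nj.
  apply/negP => /(h _ _ xy) /(closed_box_meet (lohi x) (lohi y)) /(_ (Ordinal id)).
  exact/negP.
- pose rv (c : X -> nat -> nat) x : 'rV[R]_d := (\row_(j < d) (c x j)%:R)%R.
  have lohi x (j : 'I_d) : (rv lo x ord0 j <= rv hi x ord0 j)%R.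
    have := h x x I I; rewrite eqxx => /esym/negbT/hasPn /(_ (val j)).
    by rewrite mem_iota /= ltn_ord /separated orbb -leqNgt !mxE ler_nat => ->.
  exists (rv lo), (rv hi); split=> // x y xy.
  rewrite (closed_box_meet (lohi x) (lohi y)).
  have := h x y I I; rewrite xy /= => hxy; split=> [Hxy j|all].
    move: hxy; rewrite Hxy => /esym/negbT/hasPn /(_ (val j)).
    rewrite mem_iota /= ltn_ord => /(_ isT); rewrite /separated negb_or -!leqNgt.
    by rewrite !mxE !ler_nat andbC.
  apply/negPn; rewrite hxy; apply/hasPn => i; rewrite mem_iota /= => id.
  have := all (Ordinal id); rewrite !mxE !ler_nat /separated negb_or -!leqNgt.
  by rewrite andbC.
Qed.

(** Distinct edges are non-adjacent in the complement of the line graph exactly when they meet; the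
    minimum is handled by [separable_leq]. *)
Lemma boxicity_separable (T : finType) (G : sgraph T) k :
  (boxicity R (compl_graph (line_graph G)) <= k) <->
  separable (@meets T) (induced_edge G predT) k.
Proof.
set L := compl_graph _.
have LN (x y : edge_type G) : (x != y) && ~~ L x y = meets (val x) (val y).
  rewrite /= /compl_rel /= /line_rel /meets (inj_eq val_inj).
  by case: eqP => //=; rewrite negbK.
have edgeP e : induced_edge G predT e <-> e \in edges G.
  split=> [[u [v [_ _ uv ->]]]|/imsetP[[u v]]]; last first.
    by rewrite inE /= => uv ->; exists u, v.
  by apply/imsetP; exists (u, v) => //; rewrite inE.
have transport d : separable (fun x y => (x != y) && ~~ L x y) (fun=> True) d <->
    separable (@meets T) (induced_edge G predT) d.
  split=> -[lo [hi h]].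
    pose ext (c : edge_type G -> nat -> nat) e i := if insub e is Some x then c x i else 0.
    exists (ext lo), (ext hi) => e f /edgeP Ee /edgeP Ef.
    have := h (exist _ e Ee) (exist _ f Ef) I I; rewrite LN => ->.
    by apply: eq_has => i; rewrite /separated /ext !insubT.
  exists (fun x => lo (val x)), (fun x => hi (val x)) => x y _ _; rewrite LN.
  by apply: h; apply/edgeP; apply: valP.
rewrite /boxicity; case: ex_minnP => m /asboolP rep minm; split=> [mk|s].
  by apply/transport; apply: separable_leq mk _; apply/box_representable_separable.
by apply: minm; apply/asboolP/box_representable_separable/transport.
Qed.

End Boxes.

(** * The program *)

Definition ENot a := EIf a (EC 0) (EC 1).
Definition EAnd a b := EIf a b (EC 0).
Definition EOr a b := EIf a (EC 1) b.
Definition ECount poly m b := EBig OpAdd 0 poly m b.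
Definition EHas poly m b := EOp OpLt (EC 0) (ECount poly m b).

(** * Rules for the values of safe expressions *)

Section Denotation.
Variables (B n k n1 H : nat) (M : nat -> nat).
Hypothesis B_gt1 : 1 < B.

Definition denotes (e : expr) (env : seq nat) (v : nat) : Prop :=
  safe B n k n1 H M e env /\ eval n k M e env = v.

Lemma denotes_var i env v : nth n env i = v -> v < B -> denotes (EVar i) env v.
Proof. by move=> <-. Qed.

Lemma denotes_const v env : v < B -> denotes (EC v) env v.
Proof. by []. Qed.

Lemma denotes_bool (b : bool) env : denotes (EC b) env b.
Proof. by apply: denotes_const; apply: leq_ltn_trans B_gt1; apply: leq_b1. Qed.

Lemma denotes_op o a b env x y :
  denotes a env x -> denotes b env y -> eval_op o x y < B ->
  denotes (EOp o a b) env (eval_op o x y).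
Proof. by move=> [sa ea] [sb eb] h; split; rewrite /= ?ea ?eb. Qed.

Lemma denotes_lt a b env x y :
  denotes a env x -> denotes b env y -> denotes (EOp OpLt a b) env (x < y).
Proof.
move=> ha hb; apply: (denotes_op ha hb).
by apply: leq_ltn_trans B_gt1; apply: leq_b1.
Qed.

Lemma denotes_eq a b env x y :
  denotes a env x -> denotes b env y -> denotes (EOp OpEq a b) env (x == y).
Proof.
move=> ha hb; apply: (denotes_op ha hb).
by apply: leq_ltn_trans B_gt1; apply: leq_b1.
Qed.

Lemma denotes_eqb a b env (x y : bool) :
  denotes a env x -> denotes b env y -> denotes (EOp OpEq a b) env (x == y).
Proof. by move=> ha hb; have := denotes_eq ha hb; case: (x); case: (y). Qed.

Lemma denotes_mem a env x : denotes a env x -> M x < B -> denotes (EMem a) env (M x).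
Proof. by move=> [sa ea] h; split; rewrite /= ?ea. Qed.

Lemma denotes_let a b env x y :
  denotes a env x -> denotes b (x :: env) y -> denotes (ELet a b) env y.
Proof. by move=> [sa ea] [sb eb]; split; rewrite /= ?ea. Qed.

(** Only the branch taken has to be safe; thus a test such as that for an edge can guard the
    computation after it. *)
Lemma denotes_if a b c env (x : bool) y z :
  denotes a env x -> (x -> denotes b env y) -> (~~ x -> denotes c env z) ->
  denotes (EIf a b c) env (if x then y else z).
Proof.
move=> [sa ea]; case: x ea => ea hb hc; [case: (hb isT)|case: (hc isT)];
  by move=> s e; split; rewrite /= ?ea.
Qed.

Lemma denotes_not a env (x : bool) : denotes a env x -> denotes (ENot a) env (~~ x).
Proof.
move=> ha; have := denotes_if ha (fun=> denotes_bool false env) (fun=> denotes_bool true env).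
by case: (x).
Qed.

Lemma denotes_and a b env (x y : bool) :
  denotes a env x -> (x -> denotes b env y) -> denotes (EAnd a b) env (x && y).
Proof.
move=> ha hb; have := denotes_if ha hb (fun=> denotes_bool false env).
by case: (x).
Qed.

Lemma denotes_or a b env (x y : bool) :
  denotes a env x -> denotes b env y -> denotes (EOr a b) env (x || y).
Proof.
move=> ha hb; have := denotes_if ha (fun=> denotes_bool true env) (fun=> hb).
by case: (x).
Qed.

Lemma denotes_count poly m b env N (F : pred nat) :
  denotes m env N -> N <= (if poly then n1 else H) ->
  (forall i, i < N -> denotes b (i :: env) (F i)) ->
  denotes (ECount poly m b) env (count F (iota 0 N)).
Proof.
move=> [sm em] Nle hb; have NB : N < B by rewrite -em; exact: safe_eval sm.
have acc j : j <= N ->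
    iteri j (fun i acc => eval_op OpAdd acc (eval n k M b (i :: env))) 0 =
    count F (iota 0 j).
  elim: j => // j IHj jN; rewrite [LHS]/= IHj; last exact: ltnW.
  by rewrite (hb j jN).2 -[j.+1]addn1 iotaD count_cat /= addn0.
split; rewrite /= em ?acc //; split=> // j jN; first by have [] := hb j jN.
rewrite acc //; apply: leq_ltn_trans NB; apply: leq_trans jN.
by rewrite -{2}(size_iota 0 j) count_size.
Qed.

Lemma denotes_has poly m b env N (F : pred nat) :
  denotes m env N -> N <= (if poly then n1 else H) ->
  (forall i, i < N -> denotes b (i :: env) (F i)) ->
  denotes (EHas poly m b) env (has F (iota 0 N)).
Proof.
move=> hm Nle hb; rewrite has_count.
exact: (denotes_lt (denotes_bool false env) (denotes_count hm Nle hb)).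
Qed.

End Denotation.

Definition eadj u v := EMem (EOp OpAdd (EOp OpMul (EVar u) EN) (EVar v)).
(** Here and below the arguments are indices of bound variables: each further binder shifts them by
    one, and 0 is the innermost variable. *)
Definition ecore u := EOp OpLt (EC 1) (ECount true EN (eadj u.+1 0)).
Definition ekept v :=
  EOr (ecore v)
    (EHas true EN (EAnd (eadj 0 v.+1) (EAnd (ecore 0)
      (EOp OpLt
        (ECount true EN (EAnd (EOp OpLt (EVar 0) (EVar v.+2))
                              (EAnd (eadj 1 0) (ENot (ecore 0)))))
        (EC 2))))).
Definition erank v :=
  ECount true EN (EAnd (EOp OpLt (EVar 0) (EVar v.+1)) (ekept 0)).
Definition ewidth := EOp OpMul (EC 24) EK.
Definition ebase := EOp OpMul ewidth ewidth.
Definition elength := EOp OpMul (EOp OpMul (EC 2) EK) ebase.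
Definition epow p := EBig OpMul 1 false p ebase.
Definition edigit x p := EOp OpMod (EOp OpDiv (EVar x) (epow p)) ebase.
Definition eposition i a := EOp OpMul (EC 2) (EOp OpAdd (EOp OpMul (EVar i) ebase) (EVar a)).
Definition elo x i a := edigit x (eposition i a).
Definition ehi x i a := edigit x (EOp OpAdd (eposition i a) (EC 1)).
Definition eseparated x i a b :=
  EOr (EOp OpLt (ehi x i a) (elo x i b)) (EOp OpLt (ehi x i b) (elo x i a)).
Definition eedge u v :=
  EAnd (EOp OpLt (EVar u) (EVar v)) (EAnd (eadj u v) (EAnd (ekept u) (ekept v))).
Definition eindex u v := EOp OpAdd (EOp OpMul (erank u) ewidth) (erank v).
Definition eshare u v u' v' :=
  EOp OpAdd (EOp OpAdd (EOp OpAdd (EOp OpEq (EVar u) (EVar u'))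
                                  (EOp OpEq (EVar u) (EVar v')))
                       (EOp OpEq (EVar v) (EVar u')))
            (EOp OpEq (EVar v) (EVar v')).
(** Innermost first, the variables at the test are [c'], [v'], [u'], [c], [v], [u], [x], with [c]
    and [c'] the indices of the two edges; the loop over coordinates puts one more in front. *)
Definition ebad :=
  EHas true EN (EHas true EN (EAnd (eedge 1 0) (ELet (eindex 1 0)
    (EHas true EN (EHas true EN (EAnd (eedge 1 0) (ELet (eindex 1 0)
      (ENot (EOp OpEq (EOp OpEq (eshare 5 4 2 1) (EC 1))
                      (EHas false EK (eseparated 7 0 4 1))))))))))).
(** The size test guards the search: it keeps the edge indices below the base. *)
Definition emain :=
  EAnd (EOp OpLt (ECount true EN (ekept 0)) (EOp OpAdd ewidth (EC 1)))
       (EHas false (epow elength) (ENot ebad)).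

(** * The functions computed by the program, and its safety *)

Section Program.
Variables (n k : nat) (a : rel nat).

Definition coren u : bool := 1 < count (a u) (iota 0 n).
Definition keptn v : bool := coren v ||
  has (fun u => [&& a u v, coren u &
    count (fun w => [&& w < v, a u w & ~~ coren w]) (iota 0 n) < 2]) (iota 0 n).
Definition rankn v : nat := count (fun w => (w < v) && keptn w) (iota 0 n).
(** With at most [width] kept vertices, [base] bounds the edge indices and the number of kernel
    edges, hence the endpoint ranks; a code has one digit for each end, coordinate and index. *)
Definition width : nat := 24 * k.
Definition base : nat := width * width.
Definition code_length : nat := 2 * k * base.
(* The digits of x in base [base] code the endpoints: position i c and its
   successor hold the left and right endpoint, in coordinate i, of the kernel
   edge of index c. *)
Definition digit x p : nat := x %/ base ^ p %% base.
Definition position i c : nat := 2 * (i * base + c).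
Definition separatedn x c c' i : bool :=
  (digit x (position i c + 1) < digit x (position i c')) ||
  (digit x (position i c' + 1) < digit x (position i c)).
Definition edgen u v : bool := [&& u < v, a u v, keptn u & keptn v].
Definition indexn u v : nat := rankn u * width + rankn v.
Definition sharen (u v u' v' : nat) : nat :=
  (u == u') + (u == v') + (v == u') + (v == v').
Definition badn x : bool :=
  has (fun u => has (fun v => edgen u v &&
    has (fun u' => has (fun v' => edgen u' v' &&
      ~~ ((sharen u v u' v' == 1) ==
          has (separatedn x (indexn u v) (indexn u' v')) (iota 0 k)))
      (iota 0 n)) (iota 0 n)) (iota 0 n)) (iota 0 n).
Definition mainn : bool :=
  (count keptn (iota 0 n) < width + 1) &&
  has (fun x => ~~ badn x) (iota 0 (base ^ code_length)).
(** One bound for all loops not over vertices: those over codes, over the factors of a power and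
    over coordinates. *)
Definition kbound : nat := base ^ code_length + code_length.

Lemma rankn_lt v : v < n -> keptn v -> rankn v < count keptn (iota 0 n).
Proof.
move=> vn kv; rewrite /rankn -(subnKC (ltnW vn)) iotaD !count_cat add0n.
have -> : n - v = (n - v).-1.+1 by lia.
rewrite /= kv ltnn /= add0n addnCA addnA addnC add1n ltnS.
rewrite addnC; apply: leq_add; apply: sub_count => w /=; by case/andP.
Qed.

Lemma position_lt i c : i < k -> c < base -> position i c + 1 < code_length.
Proof. by rewrite /position /code_length => ik cb; nia. Qed.

Variables (B n1 : nat) (M : nat -> nat).
Hypothesis k_gt0 : 0 < k.
Hypothesis n_le : n <= n1.
Hypothesis nB : n * n + n < B.
Hypothesis kB : kbound < B.
Hypothesis Ma : forall u v, u < n -> v < n -> M (u * n + v) = a u v.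

Let base_gt0 : 0 < base. Proof. by rewrite /base /width; lia. Qed.
Let width_gt1 : 1 < width. Proof. by rewrite /width; lia. Qed.
Let width_le : width <= base. Proof. by rewrite /base; nia. Qed.
Let base_le : base <= code_length. Proof. by rewrite /code_length; nia. Qed.
Let k_le : 2 * k <= code_length. Proof. by rewrite /code_length; nia. Qed.
Let length_le : code_length <= kbound. Proof. exact: leq_addl. Qed.
Let width_ltB : width < B. Proof. lia. Qed.
Let B_gt24 : 24 < B. Proof. by apply: leq_ltn_trans width_ltB; rewrite /width; lia. Qed.
Let B_gt1 : 1 < B. Proof. lia. Qed.
Let n_ltB : n < B. Proof. lia. Qed.

Notation den := (denotes B n k n1 kbound M).

Lemma den_n env : den EN env n. Proof. by []. Qed.
Lemma den_k env : den EK env k. Proof. by split=> //=; lia. Qed.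

Lemma den_vertex i env v : nth n env i = v -> v < n -> den (EVar i) env v.
Proof. by move=> e vn; apply: denotes_var => //; lia. Qed.

Lemma den_adj i j env u v :
  nth n env i = u -> nth n env j = v -> u < n -> v < n -> den (eadj i j) env (a u v).
Proof.
move=> ei ej un vn; rewrite -Ma //; apply: denotes_mem; last first.
  by rewrite Ma //; apply: leq_ltn_trans B_gt1; apply: leq_b1.
have l1 : u * n < B by nia.
apply: (@denotes_op _ _ _ _ _ _ OpAdd _ _ _ (u * n)).
- exact: (@denotes_op _ _ _ _ _ _ OpMul _ _ _ _ _ (den_vertex ei un) (den_n env) l1).
- exact: den_vertex.
- by rewrite /eval_op; nia.
Qed.

Lemma den_core i env u : nth n env i = u -> u < n -> den (ecore i) env (coren u).
Proof.
move=> ei un; apply: denotes_lt => //.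
by apply: denotes_count => // j jn; apply: den_adj.
Qed.

Lemma den_kept i env v : nth n env i = v -> v < n -> den (ekept i) env (keptn v).
Proof.
move=> ei vn; apply: denotes_or => //; first exact: den_core.
apply: denotes_has => // u un.
apply: denotes_and => [//||_]; first exact: den_adj.
apply: denotes_and => [//||_]; first exact: den_core.
apply: denotes_lt => //; last by apply: denotes_const; lia.
apply: denotes_count => // w wn.
apply: denotes_and => [//||_]; first by apply: denotes_lt => //; apply: den_vertex.
apply: denotes_and => [//||_]; first exact: den_adj.
by apply: denotes_not => //; apply: den_core.
Qed.

Lemma den_rank i env v : nth n env i = v -> v < n -> den (erank i) env (rankn v).
Proof.
move=> ei vn; apply: denotes_count => // w wn.
apply: denotes_and => [//||_]; first by apply: denotes_lt => //; apply: den_vertex.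
exact: den_kept.
Qed.

Lemma den_width env : den ewidth env width.
Proof.
exact: (denotes_op (o := OpMul) (denotes_const _ _ _ _ _ _ B_gt24) (den_k env)).
Qed.

Lemma den_base env : den ebase env base.
Proof.
by apply: (denotes_op (o := OpMul) (den_width env) (den_width env)); rewrite /= -/base; lia.
Qed.

Lemma den_length env : den elength env code_length.
Proof.
have lt : 2 * k < B by lia.
apply: (@denotes_op _ _ _ _ _ _ OpMul _ _ _ (2 * k) _ _ (den_base env)).
  apply: (denotes_op (o := OpMul) (denotes_const _ _ _ _ _ _ _) (den_k env)) lt.
  by lia.
by rewrite /= -/code_length; lia.
Qed.

Lemma pow_lt p : p <= code_length -> base ^ p < B.
Proof.
move=> pl; apply: leq_ltn_trans kB; rewrite /kbound.
by apply: leq_trans (leq_addr _ _); apply: leq_pexp2l.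
Qed.

Lemma den_pow p env m : den p env m -> m <= code_length -> den (epow p) env (base ^ m).
Proof.
move=> [sp ep] ml.
have acc j : iteri j (fun i acc => eval_op OpMul acc (eval n k M ebase (i :: env))) 1 =
    base ^ j.
  by elim: j => // j IHj; rewrite iteriS IHj (den_base _).2 expnSr.
split; last by rewrite /epow -acc -ep.
split=> [//||i _|j]; rewrite ?ep.
- exact: leq_trans length_le.
- by have [] := den_base (i :: env).
- by move=> jm; rewrite acc; apply: pow_lt; apply: leq_trans ml.
Qed.

Lemma den_digit i env x p m :
  nth n env i = x -> x < base ^ code_length -> den p env m -> m <= code_length ->
  den (edigit i p) env (digit x m).
Proof.
move=> ei xl hp ml; have xB := ltn_trans xl (pow_lt (leqnn _)).
have dB : x %/ base ^ m < B by apply: leq_ltn_trans xB; apply: leq_div.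
apply: (@denotes_op _ _ _ _ _ _ OpMod _ _ _ (x %/ base ^ m) _ _ (den_base env)).
  exact: (denotes_op (o := OpDiv) (denotes_var _ _ _ _ ei xB) (den_pow hp ml) dB).
by apply: leq_ltn_trans dB; apply: leq_mod.
Qed.

Lemma den_position ii ic env i c :
  nth n env ii = i -> nth n env ic = c -> i < k -> c < base ->
  den (eposition ii ic) env (position i c).
Proof.
move=> ei ec ik cb; have := position_lt ik cb; rewrite /position => lt.
have l0 : i * base < B by nia.
have l1 : i * base + c < B by lia.
have l2 : 2 * (i * base + c) < B by lia.
have l3 : 2 < B by lia.
apply: (denotes_op (o := OpMul) (denotes_const _ _ _ _ _ _ l3) _ l2).
apply: (denotes_op (o := OpAdd)) l1; last by apply: denotes_var => //; lia.
apply: (denotes_op (o := OpMul) _ (den_base env) l0).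
by apply: denotes_var => //; lia.
Qed.

Lemma den_separated ix ii ic ic' env x i c c' :
  nth n env ix = x -> nth n env ii = i -> nth n env ic = c -> nth n env ic' = c' ->
  x < base ^ code_length -> i < k -> c < base -> c' < base ->
  den (eseparated ix ii ic ic') env (separatedn x c c' i).
Proof.
move=> ex ei ec ec' xl ik cb cb'.
have lo j d : nth n env j = d -> d < base -> den (elo ix ii j) env (digit x (position i d)).
  move=> ej db; apply: den_digit => //; first exact: den_position.
  by have := position_lt ik db; lia.
have hi j d : nth n env j = d -> d < base -> den (ehi ix ii j) env (digit x (position i d + 1)).
  move=> ej db; have lt := position_lt ik db.
  apply: den_digit => //; last by lia.
  apply: (denotes_op (o := OpAdd)) => //=; first exact: den_position.
  by lia.
by apply: denotes_or => //; apply: denotes_lt => //; auto.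
Qed.

Lemma den_edge iu iv env u v :
  nth n env iu = u -> nth n env iv = v -> u < n -> v < n ->
  den (eedge iu iv) env (edgen u v).
Proof.
move=> eu ev un vn.
apply: denotes_and => [//||_]; first by apply: denotes_lt => //; apply: den_vertex.
apply: denotes_and => [//||_]; first exact: den_adj.
by apply: denotes_and => [//||_]; apply: den_kept.
Qed.

Lemma indexn_lt u v : count keptn (iota 0 n) < width + 1 ->
  u < n -> v < n -> edgen u v -> indexn u v < base.
Proof.
move=> cw un vn /and4P[_ _ ku kv]; have := rankn_lt un ku; have := rankn_lt vn kv.
by rewrite /indexn /base; nia.
Qed.

Lemma den_index iu iv env u v : count keptn (iota 0 n) < width + 1 ->
  nth n env iu = u -> nth n env iv = v -> u < n -> v < n -> edgen u v ->
  den (eindex iu iv) env (indexn u v).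
Proof.
move=> cw eu ev un vn uv; have := indexn_lt cw un vn uv; rewrite /indexn => lt.
have l1 : rankn u * width < B by lia.
apply: (denotes_op (o := OpAdd) _ (den_rank ev vn)) => /=; last by lia.
exact: (denotes_op (o := OpMul) (den_rank eu un) (den_width env) l1).
Qed.

Lemma den_share iu iv iu' iv' env u v u' v' :
  nth n env iu = u -> nth n env iv = v -> nth n env iu' = u' -> nth n env iv' = v' ->
  u < n -> v < n -> u' < n -> v' < n ->
  den (eshare iu iv iu' iv') env (sharen u v u' v').
Proof.
move=> eu ev eu' ev' un vn un' vn'.
have eq i j x y : nth n env i = x -> nth n env j = y -> x < n -> y < n ->
    den (EOp OpEq (EVar i) (EVar j)) env (x == y).
  by move=> ei ej xn yn; apply: denotes_eq => //; apply: den_vertex.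
have B4 : 4 < B by lia.
have b4 (x y z t : bool) : x + y + z + t < B by lia.
do 3?[apply: (denotes_op (o := OpAdd)); rewrite /eval_op; last first]; try exact: eq.
all: by have := b4 (u == u') (u == v') (v == u') (v == v'); lia.
Qed.

Lemma denotes_main : den emain [::] mainn.
Proof.
apply: denotes_and => [//||cw].
  apply: denotes_lt => //; first by apply: denotes_count => // v vn; apply: den_kept.
  apply: (denotes_op (o := OpAdd) (den_width _) (denotes_const _ _ _ _ _ _ _)) => //=.
  by have : width < base by [rewrite /base; nia]; lia.
apply: denotes_has => [//|||x xl]; first exact: (den_pow (den_length _)).
  exact: leq_addr.
apply: denotes_not => //.
apply: denotes_has => // u un; apply: denotes_has => // v vn.
apply: denotes_and => [//||uv]; first exact: den_edge.
apply: denotes_let; first by apply: (@den_index _ _ _ u v cw).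
apply: denotes_has => // u' un'; apply: denotes_has => // v' vn'.
apply: denotes_and => [//||uv']; first exact: den_edge.
apply: denotes_let; first by apply: (@den_index _ _ _ u' v' cw).
apply: denotes_not => //; apply: denotes_eqb => //.
  by apply: denotes_eq => //; apply: den_share.
apply: denotes_has => [//|||i ik]; first exact: den_k.
  by have := k_le; lia.
by apply: den_separated => //; apply: indexn_lt.
Qed.

End Program.

(** Four loops choose the ends of two edges; inside them [erank] nests four more, over the earlier
    vertices, the neighbours in [ekept], their leaves and, in [ecore], the neighbours again. *)
Lemma loop_depth_main : loop_depth true emain = 8.
Proof. by []. Qed.

(** * Correctness *)

(** A digit [g l] is put in front; its weight [b ^ l] is a multiple of [b ^ p * b] for [p < l], so
    the lower digits do not change. *)
Lemma digits_surj b l (g : nat -> nat) : 0 < b -> (forall p, g p < b) ->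
  exists2 x, x < b ^ l & forall p, p < l -> x %/ b ^ p %% b = g p.
Proof.
move=> b0 gb; elim: l => [|l [x xl hx]]; first by exists 0.
have bl : 0 < b ^ l by rewrite expn_gt0 b0.
exists (x + g l * b ^ l) => [|p].
  by have := gb l; rewrite expnS; nia.
rewrite ltnS leq_eqVlt => /orP[/eqP->|pl].
  by rewrite addnC divnMDl // (divn_small xl) addn0 modn_small.
have -> : b ^ l = b ^ (l - p).-1 * b * b ^ p by rewrite -expnSr -expnD; congr (b ^ _); lia.
by rewrite addnC !mulnA divnMDl ?expn_gt0 ?b0 // modnMDl hx.
Qed.

Section Correctness.
Variables (n : nat) (G : sgraph 'I_n).

Lemma count_ord (P : pred nat) : count P (iota 0 n) = #|[pred i : 'I_n | P i]|.
Proof. by rewrite -val_enum_ord count_map cardE enumT size_filter. Qed.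

Lemma has_ord (P : pred nat) : has P (iota 0 n) = [exists i : 'I_n, P i].
Proof.
apply/hasP/existsP => [[i]|[i Pi]]; last by exists (val i); rewrite ?mem_iota /=.
by rewrite mem_iota /= => ilt Pi; exists (Ordinal ilt).
Qed.

(** This is literally the content of memory cell [u * n + v] in [graph_input]. *)
Definition adjn (u v : nat) : bool :=
  [exists i : 'I_n, exists j : 'I_n, (u * n + v == i * n + j) && G i j].

Lemma adjn_ord (u v : 'I_n) : adjn u v = G u v.
Proof.
apply/existsP/idP => [[i /existsP[j /andP[/eqP e ij]]]|uv]; last first.
  by exists u; apply/existsP; exists v; rewrite eqxx.
have n_gt0 : 0 < n by apply: leq_ltn_trans (ltn_ord u).
have ui : u = i.
  apply: val_inj => /=; have := congr1 (divn^~ n) e.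
  by rewrite !divnMDl // !divn_small // !addn0.
have vj : v = j.
  apply: val_inj => /=; have := congr1 (modn^~ n) e.
  by rewrite !modnMDl !modn_small.
by rewrite ui vj.
Qed.

Lemma coren_ord (u : 'I_n) : coren n adjn u = core G u.
Proof.
by rewrite /coren /core count_ord; congr (_ < _); apply: eq_card => v; rewrite !inE adjn_ord.
Qed.

Lemma keptn_ord (v : 'I_n) : keptn n adjn v = kept G v.
Proof.
rewrite /keptn /kept coren_ord has_ord; congr (_ || _); apply: eq_existsb => u.
rewrite adjn_ord coren_ord count_ord; congr [&& _, _ & _ < _].
by apply: eq_card => w; rewrite !inE adjn_ord coren_ord.
Qed.

Lemma count_keptn : count (keptn n adjn) (iota 0 n) = #|[set v | kept G v]|.
Proof. by rewrite count_ord; apply: eq_card => v; rewrite !inE keptn_ord. Qed.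

Lemma rankn_inj (u v : 'I_n) :
  kept G u -> kept G v -> rankn n adjn u = rankn n adjn v -> u = v.
Proof.
have lt (x y : 'I_n) : kept G x -> x < y -> rankn n adjn x < rankn n adjn y.
  move=> kx xy; rewrite /rankn !count_ord; apply: proper_card.
  rewrite properE; apply/andP; split; apply/subsetP.
    by move=> w; rewrite !inE => /andP[wx ->]; rewrite (ltn_trans wx xy).
  by move/(_ x); rewrite !inE xy keptn_ord kx ltnn => /(_ isT).
move=> ku kv e; case: (ltngtP u v) => [uv|uv|/val_inj //].
  by have := lt _ _ ku uv; rewrite e ltnn.
by have := lt _ _ kv uv; rewrite e ltnn.
Qed.

Lemma induced_edge_ordered (S : pred 'I_n) e : induced_edge G S e ->
  exists u v : 'I_n, [/\ u < v, S u, S v, G u v & e = [set u; v]].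
Proof.
case=> u [v [Su Sv uv ->]]; case: (ltngtP u v) => [lt|lt|/val_inj euv].
- by exists u, v.
- by exists v, u; rewrite setUC adj_sym.
- by rewrite euv adj_irr in uv.
Qed.

Lemma set2_ordered (u v u' v' : 'I_n) : u < v -> u' < v' ->
  ([set u; v] == [set u'; v']) = (u == u') && (v == v').
Proof.
move=> uv uv'; apply/eqP/andP => [e|[/eqP-> /eqP-> //]].
have /setP/(_ u) := e; have /setP/(_ v) := e.
have /setP/(_ u') := e; have /setP/(_ v') := e.
by rewrite !inE -!val_eqE /= !eqxx ?orbT /=; lia.
Qed.

(** For ordered ends the number of coincidences is 0 for disjoint edges, 1 for edges that meet, and
    2 for equal ones. *)
Lemma meets_ordered (u v u' v' : 'I_n) : u < v -> u' < v' ->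
  meets [set u; v] [set u'; v'] = (sharen u v u' v' == 1).
Proof.
move=> uv uv'; rewrite /meets set2_ordered //.
have -> : ([set u; v] :&: [set u'; v'] != set0) =
    [|| u == u', u == v', v == u' | v == v'].
  apply/set0Pn/or4P => [[x]|].
    by rewrite !inE => /andP[/orP[]/eqP-> /orP[]->]; constructor.
  by case=> /eqP e; [exists u|exists u|exists v|exists v]; rewrite !inE -?e !eqxx ?orbT //= e eqxx ?orbT.
by rewrite /sharen -!val_eqE /=; lia.
Qed.

Variable k : nat.
Hypothesis k_gt0 : 0 < k.

Lemma badnP x :
  reflect (forall u v u' v' : 'I_n, u < v -> u' < v' ->
      G u v -> G u' v' -> kept G u -> kept G v -> kept G u' -> kept G v' ->
      meets [set u; v] [set u'; v'] =
      has (separatedn k x (indexn n k adjn u v) (indexn n k adjn u' v')) (iota 0 k))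
    (~~ badn n k adjn x).
Proof.
rewrite /badn has_ord; apply: (iffP existsPn) => [h u v u' v' uv uv' Guv Guv' ku kv ku' kv'|h u].
  have := h u; rewrite has_ord => /existsPn/(_ v).
  rewrite {1}/edgen uv adjn_ord Guv !keptn_ord ku kv /= has_ord => /existsPn/(_ u').
  rewrite has_ord => /existsPn/(_ v').
  rewrite /edgen uv' adjn_ord Guv' !keptn_ord ku' kv' /= negbK => /eqP <-.
  exact: meets_ordered.
rewrite has_ord; apply/existsPn => v; apply/negP => /andP[].
rewrite {1}/edgen adjn_ord !keptn_ord => /and4P[uv Guv ku kv].
rewrite has_ord => /existsP[u']; rewrite has_ord => /existsP[v' /andP[]].
rewrite {1}/edgen adjn_ord !keptn_ord => /and4P[uv' Guv' ku' kv'] /negP; apply.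
by rewrite -meets_ordered // h.
Qed.

(** A good code yields endpoints by reading its digits. Conversely, endpoints are replaced by their
    ranks among the kernel edges, which are small enough to be digits. *)
Lemma mainn_separable :
  mainn n k adjn <->
  #|[set v | kept G v]| <= 24 * k /\ separable (@meets _) (induced_edge G (kept G)) k.
Proof.
rewrite /mainn count_keptn addn1 ltnS; split.
- case/andP => -> /hasP[x _ /badnP h]; split=> //.
  pose dig e i b := if [pick p : 'I_n * 'I_n | (p.1 < p.2) && (e == [set p.1; p.2])] is Some p
    then digit k x (position k i (indexn n k adjn p.1 p.2) + b) else 0.
  have digE (u v : 'I_n) i b : u < v ->
      dig [set u; v] i b = digit k x (position k i (indexn n k adjn u v) + b).
    move=> uv; rewrite /dig; case: pickP => [[u' v'] /= /andP[uv']|/(_ (u, v))].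
      by rewrite set2_ordered // => /andP[/eqP-> /eqP->].
    by rewrite /= uv eqxx.
  exists (fun e i => dig e i 0), (fun e i => dig e i 1).
  move=> e f /induced_edge_ordered[u [v [uv ku kv Guv ->]]].
  case/induced_edge_ordered => u' [v' [uv' ku' kv' Guv' ->]].
  by rewrite h //; apply: eq_has => i; rewrite /separated !digE // !addn0.
- case=> ck [lo [hi h]]; rewrite ck /=.
  pose A := [set [set p.1; p.2] | p in
    [set p : 'I_n * 'I_n | [&& kept G p.1, kept G p.2 & G p.1 p.2]]].
  have cA : #|A| <= base k.
    apply: leq_trans (leq_imset_card _ _) _.
    apply: (@leq_trans #|setX [set v | kept G v] [set v | kept G v]|).
      apply: subset_leq_card; apply/subsetP => -[u v].
      by rewrite in_setX !inE => /and3P[-> ->].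
    by rewrite cardsX leq_mul.
  have AP e : induced_edge G (kept G) e -> e \in A.
    case=> u [v [ku kv uv ->]]; apply/imsetP; exists (u, v) => //.
    by rewrite inE /= ku kv.
  pose rk i := endpoint_rank A (fun e => hi e i).
  pose val_at e i b := rk i (if b then hi e i else lo e i).
  have lohi e i : induced_edge G (kept G) e -> i < k -> lo e i <= hi e i.
    move=> Ee ik; have := h _ _ Ee Ee; rewrite meets_irr => /esym/negbT/hasPn/(_ i).
    by rewrite mem_iota /= ik /separated orbb -leqNgt => ->.
  have val_lt e i b : induced_edge G (kept G) e -> i < k -> val_at e i b < base k.
    move=> Ee ik; apply: leq_trans cA; apply: (endpoint_rank_max (AP _ Ee)).
    by case: b; rewrite leEnat // lohi.
  pose w := width k.
  have w_gt0 : 0 < w by rewrite /w /width; lia.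
  (* Inverts [indexn]: division by [w] recovers the two ranks, and kept vertices are determined by
     their ranks. *)
  pose edge_at c := [pick p : 'I_n * 'I_n | [&& kept G p.1, kept G p.2, G p.1 p.2 &
    indexn n k adjn p.1 p.2 == c]].
  have rk_lt (u : 'I_n) : kept G u -> rankn n adjn u < w.
    move=> ku; apply: leq_trans ck; rewrite -count_keptn; apply: rankn_lt => //.
    by rewrite keptn_ord.
  have index_lt (u v : 'I_n) : kept G u -> kept G v -> indexn n k adjn u v < base k.
    move=> /rk_lt ru /rk_lt rv; rewrite /indexn /base -/w; nia.
  have edge_atE (u v : 'I_n) : kept G u -> kept G v -> G u v ->
      edge_at (indexn n k adjn u v) = Some (u, v).
    move=> ku kv uv; rewrite /edge_at; case: pickP => [[u' v'] /=|/(_ (u, v))]; last first.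
      by rewrite /= ku kv uv eqxx.
    case/and4P => ku' kv' _ /eqP e.
    have eu : rankn n adjn u' = rankn n adjn u.
      have := congr1 (divn^~ w) e; rewrite /indexn -/w !divnMDl //.
      by rewrite !divn_small ?rk_lt // !addn0.
    have ev : rankn n adjn v' = rankn n adjn v.
      have := congr1 (modn^~ w) e; rewrite /indexn -/w !modnMDl.
      by rewrite !modn_small ?rk_lt.
    by rewrite (rankn_inj ku' ku eu) (rankn_inj kv' kv ev).
  have b_gt0 : 0 < base k by rewrite /base muln_gt0 w_gt0.
  (* Position [p] is read backwards: its parity tells the end, and quotient and remainder of its
     half by [base k] the coordinate and the index. Positions without an edge get 0. *)
  pose g p := let i := p %/ 2 %/ base k in
    if i < k then
      if edge_at (p %/ 2 %% base k) is Some q then val_at [set q.1; q.2] i (odd p) else 0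
    else 0.
  have gb p : g p < base k.
    rewrite /g; case: ifP => // ik; rewrite /edge_at; case: pickP => // q /and4P[k1 k2 q12 _].
    by apply: val_lt => //; exists q.1, q.2.
  have [x xl hx] := digits_surj (code_length k) b_gt0 gb.
  apply/hasP; exists x; first by rewrite mem_iota.
  apply/badnP => u v u' v' uv uv' Guv Guv' ku kv ku' kv'.
  have Ee : induced_edge G (kept G) [set u; v] by exists u, v.
  have Ef : induced_edge G (kept G) [set u'; v'] by exists u', v'.
  have digE (y z : 'I_n) i (b : bool) : kept G y -> kept G z -> G y z -> i < k ->
      digit k x (position k i (indexn n k adjn y z) + b) = val_at [set y; z] i b.
    move=> ky kz yz ik; have cb := index_lt _ _ ky kz.
    have plt : position k i (indexn n k adjn y z) + b < code_length k.
      by have := position_lt ik cb; case: (b); lia.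
    rewrite /digit hx // /g /position.
    have -> : (2 * (i * base k + indexn n k adjn y z) + b) %/ 2 = i * base k + indexn n k adjn y z.
      by case: (b); lia.
    rewrite divnMDl // (divn_small cb) addn0 ik modnMDl (modn_small cb) edge_atE //=.
    by rewrite oddD mul2n odd_double /=; case: (b).
  rewrite (h _ _ Ee Ef); apply: eq_in_has => i; rewrite mem_iota /= => ik.
  have lo0 (y z : 'I_n) : kept G y -> kept G z -> G y z ->
      digit k x (position k i (indexn n k adjn y z)) = val_at [set y; z] i false.
    by move=> ky kz yz; rewrite -digE // addn0.
  have hi1 (y z : 'I_n) : kept G y -> kept G z -> G y z ->
      digit k x (position k i (indexn n k adjn y z) + 1) = val_at [set y; z] i true.
    by move=> ky kz yz; rewrite -digE.
  rewrite /separatedn !lo0 // !hi1 // /val_at /rk /separated.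
  rewrite (endpoint_rank_lt (fun e => hi e i)) ?AP //.
  by rewrite (endpoint_rank_lt (fun e => hi e i)) ?AP.
Qed.

End Correctness.

Theorem theorem3 (R : realType) :
  exists p : ram_com, forall k : nat, 0 < k ->
    decides_in_time p k
      (fun (n : nat) (G : sgraph 'I_n) =>
         boxicity R (compl_graph (line_graph G)) <= k)
      (fun n : nat => n ^ (5 * k + 3)).
Proof.
(* Registers 0 and 1 hold [n] and [k], so the code works from register 2 upwards and the result is
   moved to register 0 at the end. *)
exists (CSeq (compile [::] 2 emain) (CCopy 0 2 0)) => k k_gt0.
pose H := kbound k.
pose T n := time_bound (maxn 1 n) H emain + 2.
(* The exponent makes [n.+2 ^ (H + 3)] exceed both [H], through a power of 2, and [n * n + n],
   through the cube. *)
exists T, (H + 3); split.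
  (* From [n = 1] on, [n ^ 8] is at most [n ^ (5 * k + 3)] because [k] is positive; the 2 in the
     constant pays for the last copy. *)
  exists (expr_size emain * H ^ loop_depth false emain + 2), 1 => n n_gt0.
  have H_gt0 : 0 < H.
    by rewrite /H /kbound addn_gt0 expn_gt0 /base /width !muln_gt0 k_gt0.
  have := time_bound_le emain n_gt0 H_gt0; rewrite loop_depth_main /T (maxn_idPr n_gt0).
  have : n ^ 8 <= n ^ (5 * k + 3) by apply: leq_pexp2l => //; lia.
  have : 0 < n ^ 8 by rewrite expn_gt0 n_gt0.
  by set x := n ^ 8; set y := n ^ _; set z := H ^ _; nia.
move=> n G; set B := n.+2 ^ (H + 3).
have HB : H < B.
  apply: (@leq_trans (2 ^ (H + 3))); last by rewrite leq_exp2r; lia.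
  by apply: leq_trans (ltn_expl H (ltnSn 1)) _; rewrite leq_exp2l // leq_addr.
have nB : n * n + n < B.
  apply: (@leq_trans (n.+2 ^ 3)); first by rewrite !expnS; nia.
  by apply: leq_pexp2l => //; lia.
have B_gt1 : 1 < B by rewrite -{1}(expn0 n.+2) ltn_exp2l //; lia.
have [sf ev] := denotes_main (M := Defs.mem (graph_input G k)) k_gt0 (leq_maxr 1 n) nB HB
  (fun u v _ _ => erefl (nat_of_bool (adjn G u v))).
have rep : represents n k (Defs.mem (graph_input G k)) [::] [::] (graph_input G k).
  by split=> // i; rewrite !nth_nil.
have [t [s [E1 l1 v1 [_ _]]]] := compile_runs B_gt1 (ltnSn 1) (isT : all (gtn 2) [::]) rep sf.
have rB : reg s 2 < B by rewrite v1; apply: safe_eval sf.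
have [s' [E2 v2 _]] := exec_copy B_gt1 rB (isT : 2 != 0).
exists (t + 2), s'; split.
- exact: exec_seq E1 E2.
- by rewrite /T leq_add2r.
- rewrite v2 v1 ev; congr nat_of_bool; apply/idP/idP.
    by move/(mainn_separable G k_gt0)/separable_kernel/(boxicity_separable R).
  by move/(boxicity_separable R)/separable_kernel/(mainn_separable G k_gt0).
Qed.
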